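(* Let $(H,R,\alpha)$ be a triangular Hom-Hopf algebra and $(B,\beta)$ a Hom-Hopf algebra. Then the category ${}_{H}\mathbb{M}$ of left $(H,\alpha)$-Hom-modules is a symmetric subcategory of the category ${}^{B}_{H}\mathbb{L}$ of left-left $(H,B)$-Hom-Long dimodules under the left $(B,\beta)$-comodule structure $\rho(m)=1_B\otimes\mu(m)$ for $m\in(M,\mu)\in{}_{H}\mathbb{M}$, where the (symmetric) braiding on ${}_{H}\mathbb{M}$ is defined by $$C_{M,N}:M\otimes N\to N\otimes M,\qquad m\otimes n\mapsto R^{(2)}\cdot\nu^{-1}(n)\otimes R^{(1)}\cdot\mu^{-1}(m),$$ for all $m\in(M,\mu)\in{}_{H}\mathbb{M}$, $n\in(N,\nu)\in{}_{H}\mathbb{M}$.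
   Context: All vector spaces, maps and tensor products are over a fixed field $k$; Sweedler notation $\Delta(c)=c_1\otimes c_2$ is used, and $\rho(m)=m_{(-1)}\otimes m_{(0)}$ for coactions. A Hom-algebra $(A,\mu_A,1_A,\alpha)$: a linear space $A$ with a linear multiplication, $1_A\in A$ and a linear bijection $\alpha:A\to A$ with $\alpha(aa')=\alpha(a)\alpha(a')$, $\alpha(1_A)=1_A$, $\alpha(a)(a'a'')=(aa')\alpha(a'')$, $a1_A=1_Aa=\alpha(a)$. A left $(A,\alpha)$-Hom-module $(M,\cdot,\mu)$: a linear space $M$, linear $\cdot:A\otimes M\to M$, and a linear bijection $\mu:M\to M$ with $\mu(a\cdot m)=\alpha(a)\cdot\mu(m)$, $\alpha(a)\cdot(a'\cdot m)=(aa')\cdot\mu(m)$, $1_A\cdot m=\mu(m)$. Morphisms are linear maps $f$ with $f(a\cdot m)=a\cdot f(m)$ commuting with the structure maps. A Hom-coalgebra $(C,\Delta,\epsilon,\beta)$: linear $\Delta:C\to C\otimes C$, $\epsilon:C\to k$, and a linear bijection $\beta$ with $\Delta(\beta(c))=\beta(c_1)\otimes\beta(c_2)$, $\epsilon\circ\beta=\epsilon$, $\beta(c_1)\otimes c_{21}\otimes c_{22}=c_{11}\otimes c_{12}\otimes\beta(c_2)$, $\epsilon(c_1)c_2=c_1\epsilon(c_2)=\beta(c)$. A left $(C,\beta)$-Hom-comodule $(M,\rho,\mu)$: linear $\rho:M\to C\otimes M$ and a linear bijection $\mu$ with $\rho(\mu(m))=\beta(m_{(-1)})\otimes\mu(m_{(0)})$,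 $\epsilon(m_{(-1)})m_{(0)}=\mu(m)$, $\beta(m_{(-1)})\otimes m_{(0)(-1)}\otimes m_{(0)(0)}=m_{(-1)1}\otimes m_{(-1)2}\otimes\mu(m_{(0)})$. Morphisms are colinear maps commuting with the structure maps. A Hom-bialgebra $(H,\alpha)$: a Hom-algebra and Hom-coalgebra with the same structure map $\alpha$ such that $\Delta(hh')=\Delta(h)\Delta(h')$, $\Delta(1)=1\otimes1$, $\epsilon(hh')=\epsilon(h)\epsilon(h')$, $\epsilon(1)=1$. It is a Hom-Hopf algebra if there is a linear map $S:H\to H$ (antipode) with $S(h_1)h_2=h_1S(h_2)=\epsilon(h)1_H$ and $S\circ\alpha=\alpha\circ S$. A quasitriangular Hom-Hopf algebra $(H,R,\alpha)$: a Hom-Hopf algebra $(H,\alpha)$ with $R=R^{(1)}\otimes R^{(2)}\in H\otimes H$ (summation understood, $r=r^{(1)}\otimes r^{(2)}$ a second copy of $R$) such that $\epsilon(R^{(1)})R^{(2)}=R^{(1)}\epsilon(R^{(2)})=1_H$; $\Delta(R^{(1)})\otimes\alpha(R^{(2)})=\alpha(R^{(1)})\otimes\alpha(r^{(1)})\otimes R^{(2)}r^{(2)}$; $\alpha(R^{(1)})\otimes\Delta(R^{(2)})=R^{(1)}r^{(1)}\otimes\alpha(r^{(2)})\otimes\alpha(R^{(2)})$; $\Delta^{cop}(h)R=R\Delta(h)$ with $\Delta^{cop}(h)=h_2\otimes h_1$; $\alpha(R^{(1)})\otimes\alpha(R^{(2)})=R^{(1)}\otimes R^{(2)}$. It is triangular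 if $R^{-1}=R^{(2)}\otimes R^{(1)}$. A left-left $(H,B)$-Hom-Long dimodule $(M,\cdot,\rho,\mu)$: $(M,\cdot,\mu)$ is a left $(H,\alpha)$-Hom-module and $(M,\rho,\mu)$ is a left $(B,\beta)$-Hom-comodule with $\rho(h\cdot m)=\beta(m_{(-1)})\otimes\alpha(h)\cdot m_{(0)}$. The category ${}^{B}_{H}\mathbb{L}$ has these as objects and, as morphisms, the $H$-linear $B$-colinear maps commuting with structure maps. Monoidal structure on ${}^{B}_{H}\mathbb{L}$: for $(M,\mu),(N,\nu)$, the tensor product is $(M\otimes N,\mu\otimes\nu)$ with $h\cdot(m\otimes n)=h_1\cdot m\otimes h_2\cdot n$ and $\rho(m\otimes n)=\beta^{-2}(m_{(-1)}n_{(-1)})\otimes m_{(0)}\otimes n_{(0)}$; the unit is $I=(k,\mathrm{id})$ with $h\cdot 1=\epsilon(h)$, $\rho(1)=1_B\otimes1$; for $(U,\mu),(V,\nu),(W,\omega)$ the associator is $a_{U,V,W}((u\otimes v)\otimes w)=\mu^{-1}(u)\otimes(v\otimes\omega(w))$, and the unit constraints are $l_V(\lambda\otimes v)=\lambda\nu^{-1}(v)$, $r_V(v\otimes\lambda)=\lambda\nu^{-1}(v)$ for $\lambda\in k$. A braiding $C$ on a monoidal category is a symmetry if $C_{Y,X}\circ C_{X,Y}=id_{X\otimes Y}$ for all $X,Y$; the category is then called symmetric. *)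

(* Defs.v *)
From HB Require Import structures.
From mathcomp Require Import all_boot all_order all_algebra.
From mathcomp Require Import boolp classical_sets.

Set Implicit Arguments.
Unset Strict Implicit.
Unset Printing Implicit Defensive.

Import GRing.Theory.
Local Open Scope ring_scope.
Local Open Scope quotient_scope.

(* The tensor product of two vector spaces, possibly of infinite dimension: a
   list [:: (m1, n1); ...; (mr, nr)] stands for the formal sum of the pure
   tensors mi ⊗ ni, and such sums are taken modulo the congruence tens_eq.
   A scalar acts on the first factor of every term.  Lemmas sw_tens,
   sw_linear and tens_ext below give the universal property. *)
Section TensorProduct.
Variables (k : fieldType) (M N : lmodType k).

Inductive tens_eq : seq (M * N) -> seq (M * N) -> Prop :=
| tens_eq_refl s : tens_eq s s
| tens_eq_sym s t : tens_eq s t -> tens_eq t s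
| tens_eq_trans s t u : tens_eq s t -> tens_eq t u -> tens_eq s u
| tens_eq_cat s s' t t' :
    tens_eq s s' -> tens_eq t t' -> tens_eq (s ++ t) (s' ++ t')
| tens_eq_catC s t : tens_eq (s ++ t) (t ++ s)
| tens_eq_Dl m m' n : tens_eq [:: (m + m', n)] [:: (m, n); (m', n)]
| tens_eq_Dr m n n' : tens_eq [:: (m, n + n')] [:: (m, n); (m, n')]
| tens_eq_Z (a : k) m n : tens_eq [:: (a *: m, n)] [:: (m, a *: n)]
| tens_eq_0 n : tens_eq [:: (0, n)] [::].

Definition tens_eqb (s t : seq (M * N)) : bool := `[< tens_eq s t >].

Lemma tens_eqb_refl : reflexive tens_eqb.
Proof. by move=> s; apply/asboolP; apply: tens_eq_refl. Qed.
Lemma tens_eqb_sym : symmetric tens_eqb.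
Proof. by move=> s t; apply/asboolP/asboolP; apply: tens_eq_sym. Qed.
Lemma tens_eqb_trans : transitive tens_eqb.
Proof.
by move=> s t u /asboolP h1 /asboolP h2; apply/asboolP; apply: tens_eq_trans h2.
Qed.
Canonical tens_equiv :=
  EquivRel tens_eqb tens_eqb_refl tens_eqb_sym tens_eqb_trans.

Definition tensor := {eq_quot tens_equiv}.
HB.instance Definition _ := EqQuotient.on tensor.
HB.instance Definition _ := Choice.on tensor.

Definition tens_pi (s : seq (M * N)) : tensor := \pi_tensor s.

Lemma tens_piE s t : tens_eq s t -> tens_pi s = tens_pi t.
Proof. by move=> h; apply/eqmodP/asboolP. Qed.
Lemma tens_reprK s : tens_eq (repr (tens_pi s)) s.
Proof. by apply/asboolP; rewrite -[asbool _]/(tens_eqb _ _); apply/eqmodP; rewrite reprK. Qed.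
Lemma tens_repr_pi (t : tensor) : tens_pi (repr t) = t.
Proof. exact: reprK. Qed.

Definition scale_seq (a : k) (s : seq (M * N)) := [seq (a *: p.1, p.2) | p <- s].

Lemma scale_seq_eq a s t : tens_eq s t -> tens_eq (scale_seq a s) (scale_seq a t).
Proof.
elim=> {s t} [s|s t _ h|s t u _ h1 _ h2|s s' t t' _ h1 _ h2|s t|m m' n|m n n'|b m n|n].
- exact: tens_eq_refl.
- exact: tens_eq_sym.
- exact: tens_eq_trans h1 h2.
- by rewrite /scale_seq !map_cat; apply: tens_eq_cat.
- by rewrite /scale_seq !map_cat; apply: tens_eq_catC.
- by rewrite /= scalerDr; apply: tens_eq_Dl.
- exact: tens_eq_Dr.
- by rewrite /= scalerA mulrC -scalerA; apply: tens_eq_Z.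
- by rewrite /= scaler0; apply: tens_eq_0.
Qed.

Definition tens_add (x y : tensor) := tens_pi (repr x ++ repr y).
Definition tens_scale (a : k) (x : tensor) := tens_pi (scale_seq a (repr x)).
Definition tens_opp (x : tensor) := tens_scale (-1) x.

Lemma tens_addE s t : tens_add (tens_pi s) (tens_pi t) = tens_pi (s ++ t).
Proof. by apply: tens_piE; apply: tens_eq_cat; apply: tens_reprK. Qed.
Lemma tens_scaleE a s : tens_scale a (tens_pi s) = tens_pi (scale_seq a s).
Proof. by apply: tens_piE; apply: scale_seq_eq; apply: tens_reprK. Qed.

Lemma tens_addA : associative tens_add.
Proof.
move=> x y z; rewrite -[x]tens_repr_pi -[y]tens_repr_pi -[z]tens_repr_pi.
by rewrite !tens_addE catA.
Qed.
Lemma tens_addC : commutative tens_add.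
Proof. by move=> x y; apply: tens_piE; apply: tens_eq_catC. Qed.
Lemma tens_add0 : left_id (tens_pi [::]) tens_add.
Proof. by move=> x; rewrite -[x]tens_repr_pi tens_addE. Qed.
Lemma tens_scaleD a b s :
  tens_eq (scale_seq a s ++ scale_seq b s) (scale_seq (a + b) s).
Proof.
elim: s => [|p s IH]; first exact: tens_eq_refl.
apply: tens_eq_sym; rewrite /= scalerDl.
apply: (tens_eq_trans (t := [:: (a *: p.1, p.2); (b *: p.1, p.2)]
   ++ (scale_seq a s ++ scale_seq b s))).
  rewrite -cat1s; apply: tens_eq_cat; first exact: tens_eq_Dl.
  exact: tens_eq_sym.
set x := (a *: p.1, p.2); set y := (b *: p.1, p.2).
set A := scale_seq a s; set B := scale_seq b s.
apply: (tens_eq_cat (tens_eq_refl [:: x])).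
rewrite -/(scale_seq b s) -/(scale_seq a s) -/A -/B.
rewrite -[y :: (A ++ B)]/(([:: y] ++ A) ++ B) -[y :: B]cat1s catA.
by apply: tens_eq_cat; [exact: tens_eq_catC|exact: tens_eq_refl].
Qed.
Lemma tens_scale0 s : tens_eq (scale_seq 0 s) [::].
Proof.
elim: s => [|p s IH]; first exact: tens_eq_refl.
rewrite /= scale0r -cat1s -[X in tens_eq _ X]cats0.
by apply: tens_eq_cat; [exact: tens_eq_0|exact: IH].
Qed.
Lemma scale_seq1 s : scale_seq 1 s = s.
Proof. by elim: s => //= -[m n] s ->; rewrite scale1r. Qed.
Lemma tens_addN : left_inverse (tens_pi [::]) tens_opp tens_add.
Proof.
move=> x; rewrite -[x]tens_repr_pi /tens_opp tens_scaleE tens_addE.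
apply: tens_piE; rewrite -{2}[repr x]scale_seq1.
apply: tens_eq_trans (tens_scaleD _ _ _) _; rewrite addNr; exact: tens_scale0.
Qed.
HB.instance Definition _ :=
  GRing.isZmodule.Build tensor tens_addA tens_addC tens_add0 tens_addN.

Fact tens_scaleA a b x : tens_scale a (tens_scale b x) = tens_scale (a * b) x.
Proof.
rewrite -[x]tens_repr_pi !tens_scaleE; congr tens_pi.
by rewrite /scale_seq -map_comp; apply: eq_map => p /=; rewrite scalerA.
Qed.
Fact tens_scale1 : left_id 1 tens_scale.
Proof. by move=> x; rewrite -[x]tens_repr_pi tens_scaleE scale_seq1. Qed.
Fact tens_scaleDr : right_distributive tens_scale +%R.
Proof.
move=> a x y; rewrite -[x]tens_repr_pi -[y]tens_repr_pi -![_ + _]/(tens_add _ _).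
by rewrite !(tens_addE, tens_scaleE) /scale_seq map_cat.
Qed.
Fact tens_scaleDl x : {morph tens_scale^~ x : a b / a + b}.
Proof.
move=> a b; rewrite -[x]tens_repr_pi -![_ + _ in RHS]/(tens_add _ _).
rewrite !tens_scaleE tens_addE; apply/esym/tens_piE; exact: tens_scaleD.
Qed.
HB.instance Definition _ := GRing.Zmodule_isLmodule.Build k tensor
  tens_scaleA tens_scale1 tens_scaleDr tens_scaleDl.

Definition tens (m : M) (n : N) : tensor := tens_pi [:: (m, n)].

End TensorProduct.

Notation "x ⊗ y" := (tens x y) (at level 40, left associativity).

(* \sw_(a, b <- t) E is the value at t of the linear map on the tensor product
   induced by the bilinear map (a, b) |-> E, i.e. Sweedler notation with
   t = a ⊗ b (summation understood).  It is computed on a chosen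
   representative of t, hence is meaningful only when E is bilinear in a
   and b (lemmas sw_tens and sw_linear); all the uses below are. *)
Definition sw (k : fieldType) (M N V : lmodType k) (f : M -> N -> V)
  (t : tensor M N) : V := \sum_(p <- repr t) f p.1 p.2.

Notation "\sw_ ( a , b <- t ) E" := (sw (fun a b => E) t)
  (at level 41, a name, b name, t at level 41, E at level 41,
   format "'[' \sw_ ( a ,  b  <-  t ) '/  '  E ']'").

Definition lin (k : fieldType) (U V : lmodType k) (f : U -> V) : Prop :=
  linear f.
Definition bilin (k : fieldType) (M N V : lmodType k) (f : M -> N -> V) : Prop :=
  (forall n, lin (fun m => f m n)) /\ (forall m, lin (f m)).

Section TensorTheory.
Variable k : fieldType.
Implicit Types U V W M N : lmodType k.

Definition Lin U V (f : U -> V) (h : lin f) : {linear U -> V} :=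
  HB.pack f (GRing.isLinear.Build k U V _ f h).

Definition Bilin M N V (f : M -> N -> V) (h : bilin f) :
    {bilinear M -> N -> V} :=
  HB.pack f (bilinear_isBilinear.Build k M N V *:%R *:%R f (h.1, h.2)).

Lemma tens_bilin M N : bilin (@tens k M N).
Proof.
have aux (x y : tensor M N) : x + y = tens_add x y by [].
split=> [n a m m'|m a n n'].
  rewrite aux /tens -[_ *: tens_pi _]/(tens_scale _ _) tens_scaleE tens_addE.
  exact/tens_piE/tens_eq_Dl.
rewrite aux /tens -[_ *: tens_pi _]/(tens_scale _ _) tens_scaleE tens_addE.
apply: tens_piE; apply: tens_eq_trans (tens_eq_Dr _ _ _) _.
rewrite -cat1s -[X in tens_eq _ X]cat1s; apply: tens_eq_cat; last exact: tens_eq_refl.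
exact/tens_eq_sym/tens_eq_Z.
Qed.
HB.instance Definition _ M N :=
  bilinear_isBilinear.Build k M N (tensor M N) *:%R *:%R (@tens k M N)
    ((tens_bilin M N).1, (tens_bilin M N).2).

Lemma lin0 U V (f : U -> V) : lin f -> f 0 = 0.
Proof. by move=> h; rewrite -[f]/(Lin h : _ -> _) linear0. Qed.
Lemma linD U V (f : U -> V) : lin f -> {morph f : x y / x + y}.
Proof. by move=> h x y; rewrite -[f]/(Lin h : _ -> _) linearD. Qed.
Lemma linZ U V (f : U -> V) : lin f -> forall a, {morph f : x / a *: x}.
Proof. by move=> h a x; rewrite -[f]/(Lin h : _ -> _) linearZ. Qed.
Lemma lin_sum U V (f : U -> V) I (r : seq I) (F : I -> U) : lin f ->
  f (\sum_(i <- r) F i) = \sum_(i <- r) f (F i).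
Proof. by move=> h; rewrite -[f]/(Lin h : _ -> _) linear_sum. Qed.

Section Universal.
Variables (M N V : lmodType k) (f : M -> N -> V).
Hypothesis f_bilin : bilin f.

Let seqsum (s : seq (M * N)) : V := \sum_(p <- s) f p.1 p.2.

Lemma seqsum_eq s t : tens_eq s t -> seqsum s = seqsum t.
Proof.
rewrite /seqsum; case: f_bilin => fl fr.
elim=> {s t} [//|//|s t u _ -> _ -> //|s s' t t' _ h1 _ h2|s t|m m' n|m n n'|a m n|n];
  rewrite ?big_cat ?big_cons ?big_nil //= ?addr0.
- by rewrite h1 h2.
- by rewrite addrC.
- exact: (linD (fl n)).
- exact: (linD (fr m)).
- by rewrite (linZ (fl n)) (linZ (fr m)).
- exact: (lin0 (fl n)).
Qed.

Lemma sw_pi s : sw f (tens_pi s) = seqsum s.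
Proof. exact: seqsum_eq (tens_reprK s). Qed.

Lemma sw_tens m n : sw f (m ⊗ n) = f m n.
Proof. by rewrite sw_pi /seqsum big_seq1. Qed.

Lemma sw_linear : lin (sw f).
Proof.
move=> a x y; rewrite -[x]tens_repr_pi -[y]tens_repr_pi.
rewrite -[_ + _ in LHS]/(tens_add _ _) -[_ *: _ in LHS]/(tens_scale _ _).
rewrite tens_scaleE tens_addE !sw_pi /seqsum big_cat /scale_seq big_map scaler_sumr.
by congr (_ + _); apply: eq_bigr => p _ /=; rewrite (linZ (f_bilin.1 _)).
Qed.
End Universal.

Lemma tens_piS M N (s : seq (M * N)) : tens_pi s = \sum_(p <- s) p.1 ⊗ p.2.
Proof.
elim: s => [|p s IH]; first by rewrite big_nil.
by rewrite big_cons -IH -[_ + _]/(tens_add _ _) tens_addE; case: p.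
Qed.

Lemma sw_id M N (t : tensor M N) : \sw_(m, n <- t) m ⊗ n = t.
Proof. by rewrite -[RHS]tens_repr_pi tens_piS. Qed.

Lemma sw_comp M N V W (f : V -> W) (F : M -> N -> V) t : lin f ->
  f (\sw_(m, n <- t) F m n) = \sw_(m, n <- t) f (F m n).
Proof. exact: lin_sum. Qed.

Lemma eq_sw M N V (F G : M -> N -> V) t :
  (forall m n, F m n = G m n) -> sw F t = sw G t.
Proof. by move=> h; apply: eq_bigr => p _; apply: h. Qed.

Lemma sw_swap M N M' N' V (F : M -> N -> M' -> N' -> V) t t' :
  \sw_(m, n <- t) \sw_(m', n' <- t') F m n m' n'
  = \sw_(m', n' <- t') \sw_(m, n <- t) F m n m' n'.
Proof. exact: exchange_big. Qed.

Lemma tens_ext M N V (f g : tensor M N -> V) : lin f -> lin g ->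
  (forall m n, f (m ⊗ n) = g (m ⊗ n)) -> forall t, f t = g t.
Proof.
by move=> hf hg h t; rewrite -[t]sw_id !sw_comp //; apply: eq_sw.
Qed.

Lemma lin_id U : lin (@id U). Proof. by move=> a x y. Qed.
Lemma lin_canon U V W (f : {linear V -> W}) (g : U -> V) :
  lin g -> lin (fun x => f (g x)).
Proof. by move=> h a x y; rewrite h linearP. Qed.
Lemma lin_bill U V V' W (f : {bilinear V -> V' -> W}) (g : U -> V) y :
  lin g -> lin (fun x => f (g x) y).
Proof. by move=> h a u v; rewrite h linearPl. Qed.
Lemma lin_bilr U V V' W (f : {bilinear V' -> V -> W}) (g : U -> V) y :
  lin g -> lin (fun x => f y (g x)).
Proof. by move=> h a u v; rewrite h linearPr. Qed.
Lemma lin_sw U M N V (F : U -> M -> N -> V) t :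
  (forall m n, lin (fun x => F x m n)) -> lin (fun x => sw (F x) t).
Proof.
move=> h a u v; rewrite /sw scaler_sumr -big_split /=.
by apply: eq_bigr => p _; apply: h.
Qed.
Lemma lin_swt U M N V (F : M -> N -> V) (g : U -> tensor M N) :
  bilin F -> lin g -> lin (fun x => sw F (g x)).
Proof. by move=> hF hg a u v; rewrite hg sw_linear. Qed.
Lemma lin_scall U V (g : U -> k^o) (v : V) :
  lin g -> lin (fun x => (g x : k) *: v).
Proof. by move=> h a x y; rewrite h scalerDl scalerA. Qed.
Lemma lin_scalr U V (g : U -> V) (c : k) :
  lin g -> lin (fun x => c *: g x).
Proof. by move=> h a x y; rewrite h scalerDr !scalerA mulrC. Qed.
Lemma lin_scalar U V (f : {scalar V}) (g : U -> V) :
  lin g -> lin (fun x => f (g x) : k^o).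
Proof. by move=> h a x y; rewrite h linearP. Qed.
End TensorTheory.

(* The inverse of f when f is bijective (lemmas linvK and linvKr). *)
Definition linv (k : fieldType) (U V : lmodType k) (f : U -> V) : V -> U :=
  fun y => xget 0 [set x | f x = y]%classic.

Section Linv.
Variables (k : fieldType) (U V : lmodType k) (f : U -> V).
Hypothesis bij_f : bijective f.
Lemma linvKr : cancel (linv f) f.
Proof.
case: bij_f => g fK gK y; rewrite /linv.
by apply: (@xgetPex _ 0 [set x | f x = y]%classic); exists (g y).
Qed.
Lemma linvK : cancel f (linv f).
Proof. by move=> x; apply: (bij_inj bij_f); rewrite linvKr. Qed.
Lemma linvP x y : f x = y -> linv f y = x.
Proof. by move=> <-; rewrite linvK. Qed.
End Linv.

Lemma lin_linv (k : fieldType) (U V W : lmodType k) (f : {linear U -> V})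
  (g : W -> V) : bijective f -> lin g -> lin (fun x => linv f (g x)).
Proof.
move=> bf hg a x y; apply: (bij_inj bf).
by rewrite linearP !linvKr // hg.
Qed.

Ltac lin := repeat first
  [ exact: lin_id | assumption
  | apply: lin_swt; [split=> ?|]
  | apply: lin_sw => ? ?
  | apply: lin_bill | apply: lin_bilr | apply: lin_scalar
  | apply: lin_scall | apply: lin_scalr
  | apply: lin_canon | apply: lin_linv ].
Ltac bilin := split=> ?; lin.

Lemma linear_eq (k : fieldType) (U V : lmodType k) (f g : {linear U -> V}) :
  f =1 g -> f = g.
Proof.
case: f g => [f [fm fs]] [g [gm gs]] /= /funext fg; subst g.
by congr GRing.Linear.Pack; congr GRing.Linear.Class;
  [case: fm gm => [x] [y]|case: fs gs => [x] [y]]; congr (_ _); apply: Prop_irrelevance.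
Qed.

Record category := Category {
  obj :> Type;
  Mor : obj -> obj -> Type;
  idm : forall X, Mor X X;
  compose : forall X Y Z, Mor Y Z -> Mor X Y -> Mor X Z;
  compA : forall X Y Z W (h : Mor Z W) (g : Mor Y Z) (f : Mor X Y),
    compose h (compose g f) = compose (compose h g) f;
  comp1f : forall X Y (f : Mor X Y), compose (idm Y) f = f;
  compf1 : forall X Y (f : Mor X Y), compose f (idm X) = f }.
Arguments idm {c} X.

Notation "g ∘ f" := (compose g f) (at level 40, left associativity).

Definition is_iso (C : category) (X Y : C) (f : Mor X Y) : Prop :=
  exists g : Mor Y X, g ∘ f = idm X /\ f ∘ g = idm Y.

Reserved Notation "X ⊠ Y" (at level 39, left associativity).
Reserved Notation "f ⊠₁ g" (at level 39, left associativity).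

Record monoidal_category := MonoidalCategory {
  mon_cat :> category;
  tobj : mon_cat -> mon_cat -> mon_cat where "X ⊠ Y" := (tobj X Y);
  thom : forall X X' Y Y', Mor X X' -> Mor Y Y' -> Mor (X ⊠ Y) (X' ⊠ Y')
    where "f ⊠₁ g" := (thom f g);
  tunit : mon_cat;
  assoc : forall X Y Z, Mor ((X ⊠ Y) ⊠ Z) (X ⊠ (Y ⊠ Z));
  associnv : forall X Y Z, Mor (X ⊠ (Y ⊠ Z)) ((X ⊠ Y) ⊠ Z);
  lunit : forall X, Mor (tunit ⊠ X) X;
  runit : forall X, Mor (X ⊠ tunit) X;
  thom_id : forall X Y, idm X ⊠₁ idm Y = idm (X ⊠ Y);
  thom_comp : forall X X' X'' Y Y' Y'' (f' : Mor X' X'') (f : Mor X X')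
    (g' : Mor Y' Y'') (g : Mor Y Y'),
    (f' ∘ f) ⊠₁ (g' ∘ g) = (f' ⊠₁ g') ∘ (f ⊠₁ g);
  assocK : forall X Y Z, associnv X Y Z ∘ assoc X Y Z = idm _;
  associnvK : forall X Y Z, assoc X Y Z ∘ associnv X Y Z = idm _;
  lunit_iso : forall X, is_iso (lunit X);
  runit_iso : forall X, is_iso (runit X);
  assoc_nat : forall X X' Y Y' Z Z'
    (f : Mor X X') (g : Mor Y Y') (h : Mor Z Z'),
    assoc X' Y' Z' ∘ ((f ⊠₁ g) ⊠₁ h) = (f ⊠₁ (g ⊠₁ h)) ∘ assoc X Y Z;
  lunit_nat : forall X X' (f : Mor X X'),
    lunit X' ∘ (idm tunit ⊠₁ f) = f ∘ lunit X;
  runit_nat : forall X X' (f : Mor X X'),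
    runit X' ∘ (f ⊠₁ idm tunit) = f ∘ runit X;
  triangle : forall X Y,
    (idm X ⊠₁ lunit Y) ∘ assoc X tunit Y = runit X ⊠₁ idm Y;
  pentagon : forall W X Y Z,
    assoc W X (Y ⊠ Z) ∘ assoc (W ⊠ X) Y Z =
    (idm W ⊠₁ assoc X Y Z) ∘ assoc W (X ⊠ Y) Z ∘ (assoc W X Y ⊠₁ idm Z) }.
Arguments tunit {m}.

Notation "X ⊠ Y" := (tobj X Y).
Notation "f ⊠₁ g" := (thom f g).

(* The two hexagons are those for c X (Y ⊠ Z) and c (X ⊠ Y) Z. *)
Record is_braiding (C : monoidal_category)
    (c : forall X Y : C, Mor (X ⊠ Y) (Y ⊠ X)) : Prop := IsBraiding {
  braiding_iso : forall X Y, is_iso (c X Y);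
  braiding_nat : forall X X' Y Y' (f : Mor X X') (g : Mor Y Y'),
    c X' Y' ∘ (f ⊠₁ g) = (g ⊠₁ f) ∘ c X Y;
  braiding_hexagon : forall X Y Z,
    assoc Y Z X ∘ c X (Y ⊠ Z) ∘ assoc X Y Z =
    (idm Y ⊠₁ c X Z) ∘ assoc Y X Z ∘ (c X Y ⊠₁ idm Z);
  braiding_hexagonV : forall X Y Z,
    associnv Z X Y ∘ c (X ⊠ Y) Z ∘ associnv X Y Z =
    (c X Z ⊠₁ idm Y) ∘ associnv X Z Y ∘ (idm X ⊠₁ c Y Z) }.

Definition is_symmetry (C : monoidal_category)
    (c : forall X Y : C, Mor (X ⊠ Y) (Y ⊠ X)) : Prop :=
  is_braiding c /\ forall X Y, c Y X ∘ c X Y = idm (X ⊠ Y).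

(* A morphism packed with its domain and codomain, so that morphisms whose
   endpoints are only propositionally equal can be compared. *)
Definition arrow (C : category) := {X : C & {Y : C & Mor X Y}}.
Definition arr (C : category) (X Y : C) (f : Mor X Y) : arrow C :=
  existT _ X (existT _ Y f).

(* F, F1 embed C in D as a subcategory that contains the unit object of D, is
   closed under its tensor product, and whose monoidal structure is the
   restriction of that of D. *)
Record is_monoidal_subcategory (C D : monoidal_category) (F : C -> D)
    (F1 : forall X Y : C, Mor X Y -> Mor (F X) (F Y)) : Prop :=
    IsMonoidalSubcategory {
  sub_id : forall X, F1 X X (idm X) = idm (F X);
  sub_comp : forall X Y Z (g : Mor Y Z) (f : Mor X Y),
    F1 _ _ (g ∘ f) = F1 _ _ g ∘ F1 _ _ f;
  sub_obj_inj : injective F;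
  sub_hom_inj : forall X Y, injective (F1 X Y);
  sub_tobj : forall X Y, F (X ⊠ Y) = F X ⊠ F Y;
  sub_tunit : F tunit = tunit;
  sub_thom : forall X X' Y Y' (f : Mor X X') (g : Mor Y Y'),
    arr (F1 _ _ (f ⊠₁ g)) = arr (F1 _ _ f ⊠₁ F1 _ _ g);
  sub_assoc : forall X Y Z,
    arr (F1 _ _ (assoc X Y Z)) = arr (assoc (F X) (F Y) (F Z));
  sub_lunit : forall X, arr (F1 _ _ (lunit X)) = arr (lunit (F X));
  sub_runit : forall X, arr (F1 _ _ (runit X)) = arr (runit (F X)) }.
Arguments is_monoidal_subcategory {C D} F F1.

(* In the records below the argument or field s, hstr, mstr is the structure
   map (alpha, beta, mu, ...). *)
Record is_hom_algebra (k : fieldType) (A : lmodType k)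
    (m : {bilinear A -> A -> A}) (e : A) (s : {linear A -> A}) : Prop :=
    IsHomAlgebra {
  halg_bij : bijective s;
  halg_strM : forall a b, s (m a b) = m (s a) (s b);
  halg_str1 : s e = e;
  halg_assoc : forall a b c, m (s a) (m b c) = m (m a b) (s c);
  halg_mulr1 : forall a, m a e = s a;
  halg_mul1r : forall a, m e a = s a }.

Record is_hom_coalgebra (k : fieldType) (C : lmodType k)
    (D : {linear C -> tensor C C}) (e : {scalar C}) (s : {linear C -> C}) :
    Prop := IsHomCoalgebra {
  hcoalg_bij : bijective s;
  hcoalg_strD : forall c, D (s c) = \sw_(c1, c2 <- D c) s c1 ⊗ s c2;
  hcoalg_str0 : forall c, e (s c) = e c;
  hcoalg_coassoc : forall c,
    \sw_(c1, c2 <- D c) \sw_(c21, c22 <- D c2) s c1 ⊗ (c21 ⊗ c22) =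
    \sw_(c1, c2 <- D c) \sw_(c11, c12 <- D c1) c11 ⊗ (c12 ⊗ s c2);
  hcoalg_counitl : forall c, \sw_(c1, c2 <- D c) e c1 *: c2 = s c;
  hcoalg_counitr : forall c, \sw_(c1, c2 <- D c) e c2 *: c1 = s c }.

Record hom_hopf_algebra (k : fieldType) := HomHopfAlgebra {
  hopf_space :> lmodType k;
  hmul : {bilinear hopf_space -> hopf_space -> hopf_space};
  hone : hopf_space;
  hdelta : {linear hopf_space -> tensor hopf_space hopf_space};
  heps : {scalar hopf_space};
  hanti : {linear hopf_space -> hopf_space};
  hstr : {linear hopf_space -> hopf_space};
  hopf_algebra : is_hom_algebra hmul hone hstr;
  hopf_coalgebra : is_hom_coalgebra hdelta heps hstr;
  hopf_deltaM : forall h h', hdelta (hmul h h') =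
    \sw_(h1, h2 <- hdelta h) \sw_(h'1, h'2 <- hdelta h')
      hmul h1 h'1 ⊗ hmul h2 h'2;
  hopf_delta1 : hdelta hone = hone ⊗ hone;
  hopf_epsM : forall h h', heps (hmul h h') = heps h * heps h';
  hopf_eps1 : heps hone = 1;
  hopf_antil : forall h,
    \sw_(h1, h2 <- hdelta h) hmul (hanti h1) h2 = heps h *: hone;
  hopf_antir : forall h,
    \sw_(h1, h2 <- hdelta h) hmul h1 (hanti h2) = heps h *: hone;
  hopf_anti_str : forall h, hanti (hstr h) = hstr (hanti h) }.
Arguments hmul {k _}.
Arguments hone {k _}.
Arguments hdelta {k _}.
Arguments heps {k _}.
Arguments hanti {k _}.
Arguments hstr {k _}.

Notation "a ∙ b" := (hmul a b) (at level 39, left associativity).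

Record is_quasitriangular (k : fieldType) (H : hom_hopf_algebra k)
    (R : tensor H H) : Prop := IsQuasitriangular {
  qt_epsl : \sw_(R1, R2 <- R) heps R1 *: R2 = hone;
  qt_epsr : \sw_(R1, R2 <- R) heps R2 *: R1 = hone;
  qt_deltal :
    \sw_(R1, R2 <- R) hdelta R1 ⊗ hstr R2 =
    \sw_(R1, R2 <- R) \sw_(r1, r2 <- R) (hstr R1 ⊗ hstr r1) ⊗ (R2 ∙ r2);
  qt_deltar :
    \sw_(R1, R2 <- R) hstr R1 ⊗ hdelta R2 =
    \sw_(R1, R2 <- R) \sw_(r1, r2 <- R) (R1 ∙ r1) ⊗ (hstr r2 ⊗ hstr R2);
  qt_cop : forall h : H,
    \sw_(h1, h2 <- hdelta h) \sw_(R1, R2 <- R) (h2 ∙ R1) ⊗ (h1 ∙ R2) =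
    \sw_(R1, R2 <- R) \sw_(h1, h2 <- hdelta h) (R1 ∙ h1) ⊗ (R2 ∙ h2);
  qt_str : \sw_(R1, R2 <- R) hstr R1 ⊗ hstr R2 = R }.

Record is_triangular (k : fieldType) (H : hom_hopf_algebra k)
    (R : tensor H H) : Prop := IsTriangular {
  tri_qt : is_quasitriangular R;
  (* R1 ⊗ R2 and R2 ⊗ R1 are inverse to each other for the componentwise
     product of H ⊗ H, whose unit is 1 ⊗ 1. *)
  tri_invr :
    \sw_(R1, R2 <- R) \sw_(r1, r2 <- R) (R1 ∙ r2) ⊗ (R2 ∙ r1) = hone ⊗ hone;
  tri_invl :
    \sw_(R1, R2 <- R) \sw_(r1, r2 <- R) (r2 ∙ R1) ⊗ (r1 ∙ R2) = hone ⊗ hone }.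

Record is_hom_module (k : fieldType) (H : hom_hopf_algebra k)
    (M : lmodType k) (act : {bilinear H -> M -> M}) (s : {linear M -> M}) :
    Prop := IsHomModule {
  hmod_bij : bijective s;
  hmod_str : forall h m, s (act h m) = act (hstr h) (s m);
  hmod_actA : forall h h' m, act (hstr h) (act h' m) = act (h ∙ h') (s m);
  hmod_act1 : forall m, act hone m = s m }.

Record is_hom_comodule (k : fieldType) (B : hom_hopf_algebra k)
    (M : lmodType k) (r : {linear M -> tensor B M}) (s : {linear M -> M}) :
    Prop := IsHomComodule {
  hcom_bij : bijective s;
  hcom_str : forall m, r (s m) = \sw_(b, m0 <- r m) hstr b ⊗ s m0;
  hcom_counit : forall m, \sw_(b, m0 <- r m) heps b *: m0 = s m;
  hcom_coassoc : forall m,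
    \sw_(b, m0 <- r m) \sw_(b', m00 <- r m0) hstr b ⊗ (b' ⊗ m00) =
    \sw_(b, m0 <- r m) \sw_(b1, b2 <- hdelta b) b1 ⊗ (b2 ⊗ s m0) }.

Record hom_module (k : fieldType) (H : hom_hopf_algebra k) := HomModule {
  hm_space :> lmodType k;
  act : {bilinear H -> hm_space -> hm_space};
  mstr : {linear hm_space -> hm_space};
  hm_axioms : is_hom_module act mstr }.
Arguments act {k H _}.
Arguments mstr {k H _}.

Notation "h ▷ m" := (act h m) (at level 39, left associativity).

Record hom_module_hom (k : fieldType) (H : hom_hopf_algebra k)
    (M N : hom_module H) := HomModuleHom {
  hmh_map :> {linear M -> N};
  hmh_act : forall h m, hmh_map (h ▷ m) = h ▷ hmh_map m;
  hmh_str : forall m, hmh_map (mstr m) = mstr (hmh_map m) }.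

Record is_long_dimodule (k : fieldType) (H B : hom_hopf_algebra k)
    (M : hom_module H) (r : {linear M -> tensor B M}) : Prop :=
    IsLongDimodule {
  long_comodule : is_hom_comodule r mstr;
  long_compat : forall h m,
    r (h ▷ m) = \sw_(b, m0 <- r m) hstr b ⊗ (hstr h ▷ m0) }.

Record long_dimodule (k : fieldType) (H B : hom_hopf_algebra k) :=
    LongDimodule {
  ld_module :> hom_module H;
  coact : {linear ld_module -> tensor B ld_module};
  ld_axioms : is_long_dimodule coact }.
Arguments coact {k H B _}.

Definition is_colinear (k : fieldType) (H B : hom_hopf_algebra k)
    (M N : long_dimodule H B) (f : {linear M -> N}) : Prop :=
  forall m, coact (f m) = \sw_(b, m0 <- coact m) b ⊗ f m0.

Record long_dimodule_hom (k : fieldType) (H B : hom_hopf_algebra k)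
    (M N : long_dimodule H B) := LongDimoduleHom {
  ldh_hom :> hom_module_hom M N;
  ldh_colinear : is_colinear ldh_hom }.

Lemma sw_sw (k : fieldType) (A B M N V : lmodType k)
    (F : M -> N -> V) (G : A -> B -> tensor M N) t : bilin F ->
  sw F (\sw_(a, b <- t) G a b) = \sw_(a, b <- t) sw F (G a b).
Proof. by move=> h; apply/sw_comp/sw_linear. Qed.

Lemma tens_ext3 (k : fieldType) (U V W X : lmodType k)
    (f g : tensor (tensor U V) W -> X) : lin f -> lin g ->
  (forall u v w, f (u ⊗ v ⊗ w) = g (u ⊗ v ⊗ w)) -> forall t, f t = g t.
Proof.
move=> hf hg h; apply: tens_ext => // p w; move: p.
by apply: tens_ext => //; [move=> a x y| move=> a x y];
  rewrite (linearPl (@tens _ _ _)) (hf, hg).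
Qed.

Lemma tens_ext3r (k : fieldType) (U V W X : lmodType k)
    (f g : tensor U (tensor V W) -> X) : lin f -> lin g ->
  (forall u v w, f (u ⊗ (v ⊗ w)) = g (u ⊗ (v ⊗ w))) -> forall t, f t = g t.
Proof.
move=> hf hg h; apply: tens_ext => // u; 
by apply: tens_ext => //; [move=> a x y| move=> a x y];
  rewrite (linearPr (@tens _ _ _)) (hf, hg).
Qed.

Lemma tens_ext4 (k : fieldType) (U V W X Y : lmodType k)
    (f g : tensor (tensor (tensor U V) W) X -> Y) : lin f -> lin g ->
  (forall u v w x, f (u ⊗ v ⊗ w ⊗ x) = g (u ⊗ v ⊗ w ⊗ x)) ->
  forall t, f t = g t.
Proof.
move=> hf hg h; apply: tens_ext => // p w; move: p.
by apply: tens_ext3 => //; [move=> a x y| move=> a x y];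
  rewrite (linearPl (@tens _ _ _)) (hf, hg).
Qed.

Lemma hom_module_hom_eq (k : fieldType) (H : hom_hopf_algebra k)
    (M N : hom_module H) (f g : hom_module_hom M N) :
  (forall m, f m = g m) -> f = g.
Proof.
case: f g => [f fa fs] [g ga gs] /= /linear_eq fg; subst g.
by congr HomModuleHom; apply: Prop_irrelevance.
Qed.

Section HopfTheory.
Variables (k : fieldType) (H : hom_hopf_algebra k).

Lemma hstr_bij : bijective (hstr : H -> H).
Proof. exact: halg_bij (hopf_algebra H). Qed.

Lemma hdelta_coassoc (V : lmodType k) (G : H -> H -> H -> V) (h : H) :
  (forall b c, lin (fun a => G a b c)) ->
  (forall a c, lin (fun b => G a b c)) -> (forall a b, lin (G a b)) ->
  \sw_(h1, h2 <- hdelta h) \sw_(h21, h22 <- hdelta h2) G (hstr h1) h21 h22 =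
  \sw_(h1, h2 <- hdelta h) \sw_(h11, h12 <- hdelta h1) G h11 h12 (hstr h2).
Proof.
move=> G1 G2 G3.
pose F (a : H) (q : tensor H H) : V := \sw_(b, c <- q) G a b c.
have GF a : bilin (G a) by split=> ?; [exact: G2|exact: G3].
have bF : bilin F.
  split=> [q|a]; rewrite /F; first by apply: lin_sw => ? ?; exact: G1.
  exact: sw_linear.
have /(congr1 (sw F)) := hcoalg_coassoc (hopf_coalgebra H) h.
rewrite !sw_sw //.
under eq_sw => h1 h2.
  rewrite sw_sw //; under eq_sw => h21 h22 do rewrite sw_tens // /F sw_tens //.
  over.
move=> ->; apply: eq_sw => h1 h2; rewrite sw_sw //.
by apply: eq_sw => h11 h12; rewrite sw_tens // /F sw_tens.
Qed.
End HopfTheory.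

Section HomModules.
Variables (k : fieldType) (H : hom_hopf_algebra k).
Implicit Types M N P U V W : hom_module H.

Lemma mstr_bij M : bijective (mstr : M -> M).
Proof. exact: hmod_bij (hm_axioms M). Qed.
Lemma mstr_act M h (m : M) : mstr (h ▷ m) = hstr h ▷ mstr m.
Proof. exact: hmod_str (hm_axioms M) h m. Qed.
Lemma act_act M h h' (m : M) : hstr h ▷ (h' ▷ m) = (h ∙ h') ▷ mstr m.
Proof. exact: hmod_actA (hm_axioms M) h h' m. Qed.
Lemma linv_act M h (m : M) :
  linv mstr (h ▷ m) = linv hstr h ▷ linv mstr m.
Proof.
apply: linvP; first exact: mstr_bij.
by rewrite mstr_act !linvKr //; [exact: mstr_bij|exact: hstr_bij].
Qed.
Lemma act_one M (m : M) : hone ▷ m = mstr m.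
Proof. exact: hmod_act1 (hm_axioms M) m. Qed.

Definition hm_id M : hom_module_hom M M :=
  @HomModuleHom k H M M (Lin (@lin_id k M))
    (fun _ _ => erefl) (fun _ => erefl).

Section Comp.
Variables (M N P : hom_module H).
Variables (g : hom_module_hom N P) (f : hom_module_hom M N).
Fact hm_comp_lin : lin (fun m => g (f m)). Proof. by lin. Qed.
Fact hm_comp_act h m : Lin hm_comp_lin (h ▷ m) = h ▷ Lin hm_comp_lin m.
Proof. by rewrite /= !hmh_act. Qed.
Fact hm_comp_str m : Lin hm_comp_lin (mstr m) = mstr (Lin hm_comp_lin m).
Proof. by rewrite /= !hmh_str. Qed.
Definition hm_comp := HomModuleHom hm_comp_act hm_comp_str.
End Comp.

Fact hm_compA M N P Q (h : hom_module_hom P Q) (g : hom_module_hom N P)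
  (f : hom_module_hom M N) : hm_comp h (hm_comp g f) = hm_comp (hm_comp h g) f.
Proof. exact: hom_module_hom_eq. Qed.
Fact hm_comp1f M N (f : hom_module_hom M N) : hm_comp (hm_id N) f = f.
Proof. exact: hom_module_hom_eq. Qed.
Fact hm_compf1 M N (f : hom_module_hom M N) : hm_comp f (hm_id M) = f.
Proof. exact: hom_module_hom_eq. Qed.

Definition hom_module_category : category :=
  Category hm_compA hm_comp1f hm_compf1.

Section TensMap.
Variables (M N M' N' : lmodType k) (f : {linear M -> M'}) (g : {linear N -> N'}).
Definition tens_map (t : tensor M N) : tensor M' N' := \sw_(m, n <- t) f m ⊗ g n.
Lemma tens_map_lin : lin tens_map.
Proof. by apply: lin_swt; [bilin|lin]. Qed.
Lemma tens_mapE m n : tens_map (m ⊗ n) = f m ⊗ g n.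
Proof. by rewrite /tens_map sw_tens //; bilin. Qed.
End TensMap.

Section Tensor.
Variables M N : hom_module H.
Definition tens_act (h : H) (t : tensor M N) : tensor M N :=
  \sw_(h1, h2 <- hdelta h) \sw_(m, n <- t) (h1 ▷ m) ⊗ (h2 ▷ n).

Fact tens_act_bilin : bilin tens_act.
Proof. by split=> [n|m]; rewrite /tens_act; lin. Qed.

Lemma tens_actE h m n :
  tens_act h (m ⊗ n) = \sw_(h1, h2 <- hdelta h) (h1 ▷ m) ⊗ (h2 ▷ n).
Proof. by apply: eq_sw => h1 h2; rewrite sw_tens //; bilin. Qed.

Definition tens_str := tens_map (mstr : {linear M -> M}) (mstr : {linear N -> N}).


Lemma tens_map_bij (U V : lmodType k) (f : {linear U -> U}) (g : {linear V -> V}) :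
  bijective f -> bijective g -> bijective (tens_map f g).
Proof.
move=> bf bg.
have lf : lin (linv f) by apply: lin_linv bf (@lin_id _ _).
have lg : lin (linv g) by apply: lin_linv bg (@lin_id _ _).
have h : lin (tens_map (Lin lf) (Lin lg)) by apply: tens_map_lin.
exists (tens_map (Lin lf) (Lin lg)); apply: tens_ext; try exact: lin_id.
- exact: (lin_canon (Lin h) (tens_map_lin f g)).
- by move=> m n; rewrite !tens_mapE /= !linvK.
- exact: (lin_canon (Lin (tens_map_lin f g)) h).
- by move=> m n; rewrite !tens_mapE /= !linvKr.
Qed.

Fact tens_module :
  is_hom_module (Bilin tens_act_bilin) (Lin (tens_map_lin mstr mstr)).
Proof.
have lm := tens_map_lin (mstr : {linear M -> M}) (mstr : {linear N -> N}).
split=> /=.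
- by apply: tens_map_bij; apply: mstr_bij.
- move=> h; apply: tens_ext.
  + exact: (lin_canon (Lin lm) (tens_act_bilin.2 h)).
  + exact: (lin_canon (Bilin tens_act_bilin _) lm).
  move=> m n; rewrite tens_mapE !tens_actE sw_comp //.
  rewrite (hcoalg_strD (hopf_coalgebra H)) sw_sw; last by bilin.
  by apply: eq_sw => h1 h2; rewrite tens_mapE sw_tens ?mstr_act //; bilin.
- move=> h h'; apply: tens_ext.
  + exact: (lin_canon (Bilin tens_act_bilin _) (tens_act_bilin.2 h')).
  + exact: (lin_canon (Bilin tens_act_bilin _) lm).
  move=> m n; rewrite tens_mapE !tens_actE (sw_comp _ _ (tens_act_bilin.2 _)).
  rewrite hopf_deltaM sw_sw; last by bilin.
  under eq_sw => h1 h2. 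
  rewrite tens_actE (hcoalg_strD (hopf_coalgebra H)) sw_sw; last by bilin.
  under eq_sw => h'1 h'2. rewrite sw_tens ?act_act; last by bilin. over. over.
  rewrite sw_swap; apply: eq_sw => h1 h2; rewrite sw_sw; last by bilin.
  by apply: eq_sw => h'1 h'2; rewrite sw_tens //; bilin.
- apply: tens_ext => //.
    exact: (tens_act_bilin.2 hone).
  move=> m n; rewrite tens_mapE tens_actE hopf_delta1 sw_tens; last by bilin.
  by rewrite !act_one.
Qed.
Definition hm_tensor : hom_module H := HomModule tens_module.
End Tensor.

Section TensorHom.
Variables (M M' N N' : hom_module H).
Variables (f : hom_module_hom M M') (g : hom_module_hom N N').
Let l := tens_map_lin f g.
Fact tens_hom_act h (t : hm_tensor M N) :
  (Lin l : _ -> hm_tensor M' N') (h ▷ t) = h ▷ (Lin l t : hm_tensor M' N').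
Proof.
move: t => /=; apply: tens_ext.
- exact: (lin_canon (Lin l) ((tens_act_bilin M N).2 h)).
- exact: (lin_canon (Bilin (tens_act_bilin M' N') h) l).
move=> m n; rewrite tens_mapE !tens_actE sw_comp //.
by apply: eq_sw => h1 h2; rewrite tens_mapE !hmh_act.
Qed.
Fact tens_hom_str (t : hm_tensor M N) :
  (Lin l : _ -> hm_tensor M' N') (mstr t) = mstr (Lin l t : hm_tensor M' N').
Proof.
move: t => /=; apply: tens_ext.
- exact: (lin_canon (Lin l) (tens_map_lin _ _)).
- exact: (lin_canon (Lin (tens_map_lin _ _)) l).
by move=> m n; rewrite !tens_mapE !hmh_str.
Qed.
Definition hm_tensor_hom : hom_module_hom (hm_tensor M N) (hm_tensor M' N') :=
  HomModuleHom tens_hom_act tens_hom_str.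
End TensorHom.

Definition unit_act (h : H) (x : k^o) : k^o := heps h *: x.
Fact unit_act_bilin : bilin unit_act.
Proof. by split=> x; rewrite /unit_act; lin. Qed.
Fact unit_module :
  is_hom_module (Bilin unit_act_bilin) (Lin (@lin_id k k^o)).
Proof.
split=> //=; rewrite /unit_act.
- by exists id.
- by move=> h x; rewrite (hcoalg_str0 (hopf_coalgebra H)).
- by move=> h h' x; rewrite (hcoalg_str0 (hopf_coalgebra H)) scalerA hopf_epsM.
- by move=> x; rewrite hopf_eps1 scale1r.
Qed.
Definition hm_unit : hom_module H := HomModule unit_module.

Section Associator.
Variables U V W : hom_module H.
Definition assoc_map (t : tensor (tensor U V) W) : tensor U (tensor V W) :=
  \sw_(p, w <- t) \sw_(u, v <- p) linv mstr u ⊗ (v ⊗ mstr w).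
Definition associnv_map (t : tensor U (tensor V W)) : tensor (tensor U V) W :=
  \sw_(u, q <- t) \sw_(v, w <- q) (mstr u ⊗ v) ⊗ linv mstr w.
Let bU := mstr_bij U. Let bV := mstr_bij V. Let bW := mstr_bij W.

Fact assoc_lin : lin assoc_map.
Proof. by rewrite /assoc_map; lin; bilin. Qed.
Fact associnv_lin : lin associnv_map.
Proof. by rewrite /associnv_map; lin; bilin. Qed.
Lemma assocE u v w :
  assoc_map (u ⊗ v ⊗ w) = linv mstr u ⊗ (v ⊗ mstr w).
Proof.
rewrite /assoc_map sw_tens; last by bilin.
by rewrite sw_tens; last by bilin.
Qed.
Lemma associnvE u v w :
  associnv_map (u ⊗ (v ⊗ w)) = (mstr u ⊗ v) ⊗ linv mstr w.
Proof.
rewrite /associnv_map sw_tens; last by bilin.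
by rewrite sw_tens; last by bilin.
Qed.
Lemma assoc_mapK : cancel assoc_map associnv_map.
Proof.
apply: tens_ext3; last first.
- by move=> u v w; rewrite assocE associnvE linvKr // linvK.
- exact: lin_id.
- exact: (lin_canon (Lin associnv_lin) assoc_lin).
Qed.
Lemma associnv_mapK : cancel associnv_map assoc_map.
Proof.
apply: tens_ext3r; last first.
- by move=> u v w; rewrite associnvE assocE linvKr // linvK.
- exact: lin_id.
- exact: (lin_canon (Lin assoc_lin) associnv_lin).
Qed.

Let L := hm_tensor (hm_tensor U V) W.
Let R := hm_tensor U (hm_tensor V W).
Fact assoc_act h (t : L) : (Lin assoc_lin : L -> R) (h ▷ t) = h ▷ (Lin assoc_lin t : R).
Proof.
move: t => /=; apply: tens_ext3.
- exact: (lin_canon (Lin assoc_lin) ((tens_act_bilin (hm_tensor U V) W).2 h)).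
- exact: (lin_canon (Bilin (tens_act_bilin U (hm_tensor V W)) h) assoc_lin).
move=> u v w; rewrite assocE.
rewrite (@tens_actE (hm_tensor U V) W) (sw_comp _ _ assoc_lin).
under eq_sw => h1 h2.
  rewrite [X in X ⊗ _](@tens_actE U V).
  rewrite (sw_comp (f := fun x => assoc_map (x ⊗ _))); last by apply: (lin_canon (Lin assoc_lin)); lin.
  under eq_sw => h11 h12 do rewrite assocE.
  over.

rewrite (@tens_actE U (hm_tensor V W)).
under [RHS]eq_sw => h1 h2.
  rewrite [X in _ ⊗ X](@tens_actE V W).
  rewrite (sw_comp (f := fun x => _ ⊗ x)); last by lin.
  over.
have bH := hstr_bij H.
pose G a b c := (linv hstr a ▷ linv mstr u) ⊗ ((b ▷ v) ⊗ (c ▷ mstr w)).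
transitivity (\sw_(h1, h2 <- hdelta h) \sw_(h11, h12 <- hdelta h1)
  G h11 h12 (hstr h2)).
  apply: eq_sw => h1 h2; apply: eq_sw => h11 h12.
  by rewrite /G linv_act mstr_act.
rewrite -hdelta_coassoc; [|by move=> *; rewrite /G; lin ..].
by apply: eq_sw => h1 h2; apply: eq_sw => h21 h22; rewrite /G linvK.
Qed.
Fact assoc_str (t : L) : (Lin assoc_lin : L -> R) (mstr t) = mstr (Lin assoc_lin t : R).
Proof.
move: t => /=; apply: tens_ext3.
- exact: (lin_canon (Lin assoc_lin) (tens_map_lin _ _)).
- exact: (lin_canon (Lin (tens_map_lin _ _)) assoc_lin).
move=> u v w; rewrite assocE !tens_mapE /=.
by rewrite !tens_mapE assocE linvK // linvKr.
Qed.
Definition hm_assoc : hom_module_hom L R := HomModuleHom assoc_act assoc_str.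

Fact associnv_act h (t : R) :
  (Lin associnv_lin : R -> L) (h ▷ t) = h ▷ (Lin associnv_lin t : L).
Proof.
apply: (can_inj assoc_mapK); rewrite /= associnv_mapK.
by rewrite [RHS](assoc_act h (associnv_map t)) /= associnv_mapK.
Qed.
Fact associnv_str (t : R) :
  (Lin associnv_lin : R -> L) (mstr t) = mstr (Lin associnv_lin t : L).
Proof.
apply: (can_inj assoc_mapK); rewrite /= associnv_mapK.
by rewrite [RHS](assoc_str (associnv_map t)) /= associnv_mapK.
Qed.
Definition hm_associnv : hom_module_hom R L :=
  HomModuleHom associnv_act associnv_str.
End Associator.

Section Units.
Variable V : hom_module H.
Let bV := mstr_bij V.
Definition lunit_map (t : tensor k^o V) : V :=
  sw (fun (x : k^o) (v : V) => (x : k) *: linv mstr v) t.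
Definition runit_map (t : tensor V k^o) : V :=
  sw (fun (v : V) (x : k^o) => (x : k) *: linv mstr v) t.
Fact lunit_bilin : bilin (fun (x : k^o) (v : V) => (x : k) *: linv mstr v).
Proof. bilin. Qed.
Fact runit_bilin : bilin (fun (v : V) (x : k^o) => (x : k) *: linv mstr v).
Proof. bilin. Qed.
Fact lunit_lin : lin lunit_map. Proof. exact/sw_linear/lunit_bilin. Qed.
Fact runit_lin : lin runit_map. Proof. exact/sw_linear/runit_bilin. Qed.
Lemma lunitE x v : lunit_map (x ⊗ v) = (x : k) *: linv mstr v.
Proof. exact: sw_tens lunit_bilin _ _. Qed.
Lemma runitE v x : runit_map (v ⊗ x) = (x : k) *: linv mstr v.
Proof. exact: sw_tens runit_bilin _ _. Qed.

Fact lunit_act h (t : hm_tensor hm_unit V) :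
  Lin lunit_lin (h ▷ t) = h ▷ (Lin lunit_lin t : V).
Proof.
move: t => /=; apply: tens_ext.
- exact: (lin_canon (Lin lunit_lin) ((tens_act_bilin hm_unit V).2 h)).
- exact: (lin_bilr (act : {bilinear H -> V -> V}) h lunit_lin).
move=> x v; rewrite lunitE (@tens_actE hm_unit V) (sw_comp _ _ lunit_lin).

have bH := hstr_bij H; rewrite linearZ /= -{2}[h](linvK bH).
rewrite -(hcoalg_counitl (hopf_coalgebra H)).
rewrite (sw_comp (f := linv hstr)); last exact: lin_linv (@lin_id _ _).
rewrite (sw_comp (f := fun g => g ▷ _)); last by lin.
rewrite (sw_comp (f := fun g : V => (x : k) *: g)); last by lin.
apply: eq_sw => h1 h2; rewrite lunitE linv_act.
have /= lZ := linZ (lin_linv bH (@lin_id _ _)).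
by rewrite lZ linearZl_LR /= scalerA mulrC.
Qed.
Fact lunit_str (t : hm_tensor hm_unit V) :
  Lin lunit_lin (mstr t) = mstr (Lin lunit_lin t : V).
Proof.
move: t => /=; apply: tens_ext.
- exact: (lin_canon (Lin lunit_lin) (tens_map_lin _ _)).
- exact: (lin_canon mstr lunit_lin).
by move=> x v; rewrite tens_mapE !lunitE linearZ linvK // linvKr.
Qed.
Definition hm_lunit : hom_module_hom (hm_tensor hm_unit V) V :=
  HomModuleHom lunit_act lunit_str.

Fact runit_act h (t : hm_tensor V hm_unit) :
  Lin runit_lin (h ▷ t) = h ▷ (Lin runit_lin t : V).
Proof.
move: t => /=; apply: tens_ext.
- exact: (lin_canon (Lin runit_lin) ((tens_act_bilin V hm_unit).2 h)).
- exact: (lin_bilr (act : {bilinear H -> V -> V}) h runit_lin).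
move=> v x; rewrite runitE (@tens_actE V hm_unit) (sw_comp _ _ runit_lin).
have bH := hstr_bij H; rewrite linearZ /= -{2}[h](linvK bH).
rewrite -(hcoalg_counitr (hopf_coalgebra H)).
rewrite (sw_comp (f := linv hstr)); last exact: lin_linv (@lin_id _ _).
rewrite (sw_comp (f := fun g => g ▷ _)); last by lin.
rewrite (sw_comp (f := fun g : V => (x : k) *: g)); last by lin.
apply: eq_sw => h1 h2; rewrite runitE linv_act.
have /= lZ := linZ (lin_linv bH (@lin_id _ _)).
by rewrite lZ linearZl_LR /= scalerA mulrC.
Qed.
Fact runit_str (t : hm_tensor V hm_unit) :
  Lin runit_lin (mstr t) = mstr (Lin runit_lin t : V).
Proof.
move: t => /=; apply: tens_ext.
- exact: (lin_canon (Lin runit_lin) (tens_map_lin _ _)).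
- exact: (lin_canon mstr runit_lin).
by move=> v x; rewrite tens_mapE !runitE linearZ linvK // linvKr.
Qed.
Definition hm_runit : hom_module_hom (hm_tensor V hm_unit) V :=
  HomModuleHom runit_act runit_str.


Lemma lunit_map_bij : bijective lunit_map.
Proof.
have l : lin (fun v : V => (1 : k^o) ⊗ mstr v) by lin.
exists (fun v : V => (1 : k^o) ⊗ mstr v) => [|v]; last first.
  by rewrite lunitE scale1r linvK.
apply: tens_ext; [exact: (lin_canon (Lin l) lunit_lin)|exact: lin_id|].
move=> x v; rewrite lunitE linearZ linvKr // linearZr_LR /= -linearZl_LR /=.
by congr (_ ⊗ _); apply: mulr1.
Qed.
Lemma runit_map_bij : bijective runit_map.
Proof.
have l : lin (fun v : V => mstr v ⊗ (1 : k^o)) by lin.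
exists (fun v : V => mstr v ⊗ (1 : k^o)) => [|v]; last first.
  by rewrite runitE scale1r linvK.
apply: tens_ext; [exact: (lin_canon (Lin l) runit_lin)|exact: lin_id|].
move=> v x; rewrite runitE linearZ linvKr // linearZl_LR /= -linearZr_LR /=.
by congr (_ ⊗ _); apply: mulr1.
Qed.
End Units.

Lemma hm_hom_lin M N (f : hom_module_hom M N) : lin f.
Proof. by move=> a x y; rewrite linearP. Qed.

Section Inverse.
Variables (M N : hom_module H) (f : hom_module_hom M N).
Hypothesis f_bij : bijective f.
Fact hm_inv_lin : lin (linv f). Proof. exact: lin_linv f_bij (@lin_id _ _). Qed.
Fact hm_inv_act h m : Lin hm_inv_lin (h ▷ m) = h ▷ Lin hm_inv_lin m.
Proof. by apply: linvP; rewrite //= hmh_act linvKr. Qed.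
Fact hm_inv_str m : Lin hm_inv_lin (mstr m) = mstr (Lin hm_inv_lin m).
Proof. by apply: linvP; rewrite //= hmh_str linvKr. Qed.
Definition hm_inv : hom_module_hom N M := HomModuleHom hm_inv_act hm_inv_str.
Lemma hm_bij_iso : is_iso (f : @Mor hom_module_category M N).
Proof.
exists hm_inv; split; apply: hom_module_hom_eq => x /=.
  by rewrite linvK.
by rewrite linvKr.
Qed.
End Inverse.

Lemma hm_tens_ext M N P (f g : hom_module_hom (hm_tensor M N) P) :
  (forall m n, f (m ⊗ n) = g (m ⊗ n)) -> f = g.
Proof.
by move=> h; apply: hom_module_hom_eq; exact: (tens_ext (hm_hom_lin f) (hm_hom_lin g) h).
Qed.
Lemma hm_tens_ext3 M N P Q
    (f g : hom_module_hom (hm_tensor (hm_tensor M N) P) Q) :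
  (forall m n p, f (m ⊗ n ⊗ p) = g (m ⊗ n ⊗ p)) -> f = g.
Proof.
by move=> h; apply: hom_module_hom_eq; exact: (tens_ext3 (hm_hom_lin f) (hm_hom_lin g) h).
Qed.
Lemma hm_tens_ext4 M N P Q U
    (f g : hom_module_hom (hm_tensor (hm_tensor (hm_tensor M N) P) Q) U) :
  (forall m n p q, f (m ⊗ n ⊗ p ⊗ q) = g (m ⊗ n ⊗ p ⊗ q)) -> f = g.
Proof.
by move=> h; apply: hom_module_hom_eq; exact: (tens_ext4 (hm_hom_lin f) (hm_hom_lin g) h).
Qed.

Fact hm_tensor_id M N : hm_tensor_hom (hm_id M) (hm_id N) = hm_id (hm_tensor M N).
Proof. by apply: hm_tens_ext => m n; apply: tens_mapE. Qed.
Fact hm_tensor_comp M M' M'' N N' N'' (f' : hom_module_hom M' M'')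
    (f : hom_module_hom M M') (g' : hom_module_hom N' N'')
    (g : hom_module_hom N N') :
  hm_tensor_hom (hm_comp f' f) (hm_comp g' g)
  = hm_comp (hm_tensor_hom f' g') (hm_tensor_hom f g).
Proof. by apply: hm_tens_ext => m n; rewrite /= !tens_mapE. Qed.
Fact hm_assocK U V W : hm_comp (hm_associnv U V W) (hm_assoc U V W) = hm_id _.
Proof. by apply: hom_module_hom_eq; apply: assoc_mapK. Qed.
Fact hm_associnvK U V W : hm_comp (hm_assoc U V W) (hm_associnv U V W) = hm_id _.
Proof. by apply: hom_module_hom_eq; apply: associnv_mapK. Qed.
Lemma hm_linv M N (f : hom_module_hom M N) m :
  f (linv mstr m) = linv mstr (f m).
Proof.
by apply/esym/linvP; rewrite -?hmh_str ?linvKr //; apply: mstr_bij.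
Qed.
Fact hm_assoc_nat U U' V V' W W' (f : hom_module_hom U U')
    (g : hom_module_hom V V') (h : hom_module_hom W W') :
  hm_comp (hm_assoc U' V' W') (hm_tensor_hom (hm_tensor_hom f g) h) =
  hm_comp (hm_tensor_hom f (hm_tensor_hom g h)) (hm_assoc U V W).
Proof.
apply: hm_tens_ext3 => u v w.
by rewrite /= !(assocE, tens_mapE) /= !(assocE, tens_mapE) hmh_str hm_linv.
Qed.
Fact hm_lunit_nat V V' (f : hom_module_hom V V') :
  hm_comp (hm_lunit V') (hm_tensor_hom (hm_id hm_unit) f) =
  hm_comp f (hm_lunit V).
Proof.
apply: hm_tens_ext => x v.
by rewrite /= tens_mapE !lunitE linearZ hm_linv.
Qed.
Fact hm_runit_nat V V' (f : hom_module_hom V V') :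
  hm_comp (hm_runit V') (hm_tensor_hom f (hm_id hm_unit)) =
  hm_comp f (hm_runit V).
Proof.
apply: hm_tens_ext => v x.
by rewrite /= tens_mapE !runitE linearZ hm_linv.
Qed.
Fact hm_triangle V W :
  hm_comp (hm_tensor_hom (hm_id V) (hm_lunit W)) (hm_assoc V hm_unit W)
  = hm_tensor_hom (hm_runit V) (hm_id W).
Proof.
apply: hm_tens_ext3 => v x w.
rewrite /= (@assocE V hm_unit W) !tens_mapE /= lunitE runitE linvK; last exact: mstr_bij.
by rewrite linearZr_LR /= -linearZl_LR.
Qed.
Lemma linv_tens M N m n :
  linv (mstr : hm_tensor M N -> _) (m ⊗ n) = linv mstr m ⊗ linv mstr n.
Proof.
apply: linvP; first exact: mstr_bij.
by rewrite /= tens_mapE !linvKr //; apply: mstr_bij.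
Qed.
Fact hm_pentagon U V W X :
  hm_comp (hm_assoc U V (hm_tensor W X)) (hm_assoc (hm_tensor U V) W X) =
  hm_comp (hm_comp (hm_tensor_hom (hm_id U) (hm_assoc V W X))
    (hm_assoc U (hm_tensor V W) X)) (hm_tensor_hom (hm_assoc U V W) (hm_id X)).
Proof.
apply: hm_tens_ext4 => u v w x /=.
rewrite (@assocE (hm_tensor U V) W X) tens_mapE /= assocE.
rewrite (@assocE U (hm_tensor V W) X) tens_mapE /= assocE.
rewrite (@linv_tens U V) assocE -/(tens_map _ _) /=.
by rewrite !tens_mapE.
Qed.
Fact hm_lunit_iso V : is_iso (hm_lunit V : @Mor hom_module_category _ _).
Proof. exact: (@hm_bij_iso _ _ (hm_lunit V) (lunit_map_bij V)). Qed.
Fact hm_runit_iso V : is_iso (hm_runit V : @Mor hom_module_category _ _).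
Proof. exact: (@hm_bij_iso _ _ (hm_runit V) (runit_map_bij V)). Qed.


Definition hom_module_monoidal : monoidal_category :=
  @MonoidalCategory hom_module_category hm_tensor (@hm_tensor_hom) hm_unit
    hm_assoc hm_associnv hm_lunit hm_runit hm_tensor_id (@hm_tensor_comp)
    hm_assocK hm_associnvK hm_lunit_iso hm_runit_iso hm_assoc_nat
    hm_lunit_nat hm_runit_nat hm_triangle hm_pentagon.
End HomModules.

Lemma long_dimodule_hom_eq (k : fieldType) (H B : hom_hopf_algebra k)
    (M N : long_dimodule H B) (f g : long_dimodule_hom M N) :
  (forall m, f m = g m) -> f = g.
Proof.
case: f g => [f fa] [g ga] /= /hom_module_hom_eq fg; subst g.
by congr LongDimoduleHom; apply: Prop_irrelevance.
Qed.

Section LongDimodules.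
Variables (k : fieldType) (H B : hom_hopf_algebra k).
Implicit Types M N P U V W : long_dimodule H B.

Lemma coact_str M (m : M) :
  coact (mstr m) = \sw_(b, m0 <- coact m) hstr b ⊗ mstr m0.
Proof. exact: hcom_str (long_comodule (ld_axioms M)) m. Qed.
Lemma coact_counit M (m : M) : \sw_(b, m0 <- coact m) heps b *: m0 = mstr m.
Proof. exact: hcom_counit (long_comodule (ld_axioms M)) m. Qed.
Lemma coact_act M h (m : M) :
  coact (h ▷ m) = \sw_(b, m0 <- coact m) hstr b ⊗ (hstr h ▷ m0).
Proof. exact: long_compat (ld_axioms M) h m. Qed.

Lemma coact_coassoc M (V : lmodType k) (G : B -> B -> M -> V) (m : M) :
  (forall b c, lin (fun a => G a b c)) ->
  (forall a c, lin (fun b => G a b c)) -> (forall a b, lin (G a b)) ->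
  \sw_(b, m0 <- coact m) \sw_(b', m00 <- coact m0) G (hstr b) b' m00 =
  \sw_(b, m0 <- coact m) \sw_(b1, b2 <- hdelta b) G b1 b2 (mstr m0).
Proof.
move=> G1 G2 G3.
pose F (a : B) (q : tensor B M) : V := \sw_(b, c <- q) G a b c.
have GF a : bilin (G a) by split=> ?; [exact: G2|exact: G3].
have bF : bilin F.
  split=> [q|a]; rewrite /F; first by apply: lin_sw => ? ?; exact: G1.
  exact: sw_linear.
have /(congr1 (sw F)) := hcom_coassoc (long_comodule (ld_axioms M)) m.
rewrite !sw_sw //.
under eq_sw => h1 h2.
  rewrite sw_sw //; under eq_sw => h21 h22 do rewrite sw_tens // /F sw_tens //.
  over.
move=> ->; apply: eq_sw => h1 h2; rewrite sw_sw //.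
by apply: eq_sw => h11 h12; rewrite sw_tens // /F sw_tens.
Qed.

Fact ld_id_colinear M : is_colinear (hm_id M : {linear M -> M}).
Proof. by move=> m; rewrite /= sw_id. Qed.
Definition ld_id M : long_dimodule_hom M M := LongDimoduleHom (@ld_id_colinear M).

Fact ld_comp_colinear M N P (g : long_dimodule_hom N P)
  (f : long_dimodule_hom M N) : is_colinear (hm_comp g f).
Proof.
move=> m; rewrite /= !(ldh_colinear, sw_sw); last by bilin.
by apply: eq_sw => b m0; rewrite sw_tens //; bilin.
Qed.
Definition ld_comp M N P (g : long_dimodule_hom N P)
  (f : long_dimodule_hom M N) : long_dimodule_hom M P :=
  LongDimoduleHom (ld_comp_colinear g f).

Fact ld_compA M N P Q (h : long_dimodule_hom P Q) (g : long_dimodule_hom N P)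
  (f : long_dimodule_hom M N) : ld_comp h (ld_comp g f) = ld_comp (ld_comp h g) f.
Proof. exact: long_dimodule_hom_eq. Qed.
Fact ld_comp1f M N (f : long_dimodule_hom M N) : ld_comp (ld_id N) f = f.
Proof. exact: long_dimodule_hom_eq. Qed.
Fact ld_compf1 M N (f : long_dimodule_hom M N) : ld_comp f (ld_id M) = f.
Proof. exact: long_dimodule_hom_eq. Qed.

Definition long_dimodule_category : category :=
  Category ld_compA ld_comp1f ld_compf1.

Let bB := hstr_bij B.
Definition hstrV2 (b : B) : B := linv hstr (linv hstr b).
Lemma hstrV2_lin : lin hstrV2. Proof. by rewrite /hstrV2; lin. Qed.
Lemma lin_hstrV2 (U : lmodType k) (g : U -> B) :
  lin g -> lin (fun x => hstrV2 (g x)).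
Proof. by move=> h; apply: (lin_canon (Lin hstrV2_lin)). Qed.
Ltac linV := repeat (lin; apply: lin_hstrV2).
Lemma hstrV2_str b : hstrV2 (hstr b) = hstr (hstrV2 b).
Proof. by rewrite /hstrV2 !(linvK bB) (linvKr bB). Qed.
Lemma hstrV2_mul a b : hstrV2 (hstr a ∙ hstr b) = hstr (hstrV2 (a ∙ b)).
Proof. by rewrite -(halg_strM (hopf_algebra B)) hstrV2_str. Qed.
Lemma heps_strV b : heps (linv hstr b : B) = heps b.
Proof. by rewrite -{2}[b](linvKr bB) (hcoalg_str0 (hopf_coalgebra B)). Qed.
Lemma hdelta_strV b :
  hdelta (linv hstr b : B) = \sw_(b1, b2 <- hdelta b) linv hstr b1 ⊗ linv hstr b2.
Proof.
rewrite -{2}[b](linvKr bB) (hcoalg_strD (hopf_coalgebra B)) sw_sw; last by bilin.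
rewrite -[LHS]sw_id; apply: eq_sw => b1 b2; rewrite sw_tens; last by bilin.
by rewrite !(linvK bB).
Qed.
Lemma hdelta_strV2 b :
  hdelta (hstrV2 b) = \sw_(b1, b2 <- hdelta b) hstrV2 b1 ⊗ hstrV2 b2.
Proof.
rewrite /hstrV2 !hdelta_strV sw_sw; last by bilin.
by apply: eq_sw => b1 b2; rewrite sw_tens //; bilin.
Qed.

Section Tensor.
Variables M N : long_dimodule H B.
Definition tens_coact (t : tensor M N) : tensor B (tensor M N) :=
  \sw_(m, n <- t) \sw_(b, m0 <- coact m) \sw_(c, n0 <- coact n)
    linv hstr (linv hstr (b ∙ c)) ⊗ (m0 ⊗ n0).
Fact tens_coact_lin : lin tens_coact.
Proof. by rewrite /tens_coact; lin; bilin. Qed.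
Lemma tens_coactE m n :
  tens_coact (m ⊗ n) = \sw_(b, m0 <- coact m) \sw_(c, n0 <- coact n)
    hstrV2 (b ∙ c) ⊗ (m0 ⊗ n0).
Proof. by rewrite /tens_coact sw_tens //; bilin. Qed.
Lemma sw_tens_coact (V : lmodType k) (F : B -> tensor M N -> V) m n : bilin F ->
  sw F (tens_coact (m ⊗ n)) = \sw_(b, m0 <- coact m) \sw_(c, n0 <- coact n)
     F (hstrV2 (b ∙ c)) (m0 ⊗ n0).
Proof.
move=> bF; rewrite tens_coactE sw_sw //; apply: eq_sw => b m0.
by rewrite sw_sw //; apply: eq_sw => c n0; rewrite sw_tens.
Qed.

Fact tens_long_dimodule :
  is_long_dimodule (M := hm_tensor M N) (Lin tens_coact_lin).
Proof.
have lc := tens_coact_lin.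
have lm := tens_map_lin (mstr : {linear M -> M}) (mstr : {linear N -> N}).
have lV := hstrV2_lin.
have bc : bilin (fun (b : B) (t : tensor M N) => hstr b ⊗ tens_map mstr mstr t).
  by split=> ?; [lin|apply: lin_bilr].
split; first split.
- exact: mstr_bij.
- rewrite /=; apply: tens_ext.
  + exact: (lin_canon (Lin lc) lm).
  + exact: lin_swt.
  move=> m n; rewrite sw_tens_coact // tens_mapE tens_coactE !coact_str.
  rewrite sw_sw; last by bilin; linV.
  apply: eq_sw => b m0; rewrite sw_tens; last by bilin; linV.
  rewrite sw_sw; last by bilin; linV.
  apply: eq_sw => c n0; rewrite sw_tens; last by bilin; linV.
  by rewrite tens_mapE hstrV2_mul.
- rewrite /=; apply: tens_ext => //.
    by apply: lin_swt => //; bilin.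
  move=> m n; rewrite sw_tens_coact; last by bilin.
  rewrite tens_mapE -!coact_counit.
  rewrite (sw_comp (f := fun x => x ⊗ _)); last by lin.
  apply: eq_sw => b m0.
  rewrite (sw_comp (f := fun x => _ ⊗ x)); last by lin.
  apply: eq_sw => c n0; rewrite !heps_strV hopf_epsM.
  by rewrite linearZl_LR linearZr_LR /= scalerA.
- rewrite /=; apply: tens_ext.
  + by apply: lin_swt => //; split=> ?; lin; bilin.
  + by apply: lin_swt => //; bilin; apply: lm.
  move=> m n; rewrite !sw_tens_coact; first last.
  + by split=> ?; lin; bilin.
  + by bilin; apply: lm.
  under eq_sw => b m0.
    under eq_sw => c n0.
      rewrite sw_tens_coact; last by bilin.
      rewrite -hstrV2_mul; over.
    rewrite sw_swap; over.
  pose G1 x y (z : M) : tensor B (tensor B (tensor M N)) :=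
    \sw_(c, n0 <- coact n) \sw_(c', n00 <- coact n0)
      hstrV2 (x ∙ hstr c) ⊗ (hstrV2 (y ∙ c') ⊗ (z ⊗ n00)).
  have := @coact_coassoc M _ G1 m; rewrite {1 2}/G1 => -> //; first last.
  + by move=> *; rewrite /G1; linV.
  + by move=> *; rewrite /G1; linV.
  + by move=> *; rewrite /G1; linV.
  apply: eq_sw => b m0; rewrite /G1.
  under eq_sw => b1 b2.
    rewrite (@coact_coassoc N _ (fun x y z =>
      hstrV2 (b1 ∙ x) ⊗ (hstrV2 (b2 ∙ y) ⊗ (mstr m0 ⊗ z)))).
    over.
  all: try by move=> *; linV.
  rewrite sw_swap; apply: eq_sw => c n0.
  rewrite hdelta_strV2 hopf_deltaM tens_mapE !sw_sw; try by bilin; linV.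
  apply: eq_sw => b1 b2; rewrite !sw_sw; try by bilin; linV.
  by apply: eq_sw => c1 c2; rewrite !sw_tens //; bilin; linV.
- move=> h; rewrite /=; apply: tens_ext.
  + exact: (lin_canon (Lin lc) ((tens_act_bilin M N).2 h)).
  + apply: lin_swt => //; split=> ?; first by lin.
    exact: lin_bilr ((tens_act_bilin M N).2 _).
  move=> m n; rewrite sw_tens_coact; last first.
    by split=> ?; [lin|exact: lin_bilr ((tens_act_bilin M N).2 _)].
  rewrite tens_actE (sw_comp _ _ lc).
  under eq_sw => h1 h2.
    rewrite tens_coactE !coact_act sw_sw; last by bilin; linV.
    under eq_sw => b m0.
      rewrite sw_tens; last by bilin; linV.
      rewrite sw_sw; last by bilin; linV.
      under eq_sw => c n0.
        rewrite sw_tens; last by bilin; linV.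
        rewrite hstrV2_mul; over.
      over.
    over.
  rewrite [LHS]sw_swap; apply: eq_sw => b m0.
  rewrite [LHS]sw_swap; apply: eq_sw => c n0.
  rewrite tens_actE (hcoalg_strD (hopf_coalgebra H)) sw_sw; last by bilin.
  rewrite (sw_comp (f := fun x => _ ⊗ x)); last by lin.
  by apply: eq_sw => h1 h2; rewrite sw_tens //; bilin.
Qed.
Definition ld_tensor : long_dimodule H B := LongDimodule tens_long_dimodule.
End Tensor.

Fact ld_tensor_colinear M M' N N' (f : long_dimodule_hom M M')
    (g : long_dimodule_hom N N') :
  is_colinear (M := ld_tensor M N) (N := ld_tensor M' N') (hm_tensor_hom f g).
Proof.
have l := tens_map_lin f g.
rewrite /is_colinear /=; apply: tens_ext.
- exact: (lin_canon (Lin (@tens_coact_lin M' N')) l).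
- by apply: lin_swt (@tens_coact_lin M N); split=> ?; [lin|apply: lin_bilr].
move=> m n; rewrite sw_tens_coact; last by split=> ?; [lin|apply: lin_bilr].
rewrite tens_mapE tens_coactE !ldh_colinear sw_sw; last by bilin; linV.
apply: eq_sw => b m0; rewrite sw_tens; last by bilin; linV.
rewrite sw_sw; last by bilin; linV.
apply: eq_sw => c n0; rewrite sw_tens; last by bilin; linV.
by rewrite tens_mapE.
Qed.
Definition ld_tensor_hom M M' N N' (f : long_dimodule_hom M M')
    (g : long_dimodule_hom N N') :
    long_dimodule_hom (ld_tensor M N) (ld_tensor M' N') :=
  LongDimoduleHom (ld_tensor_colinear f g).

Definition unit_coact (x : k^o) : tensor B k^o := hone ⊗ x.
Fact unit_coact_lin : lin unit_coact.
Proof. by rewrite /unit_coact; lin. Qed.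
Fact unit_long_dimodule :
  is_long_dimodule (M := hm_unit H) (Lin unit_coact_lin).
Proof.
have s1 : hstr (hone : B) = hone by exact: halg_str1 (hopf_algebra B).
split; first split=> /=; rewrite /unit_coact.
- by exists id.
- by move=> x; rewrite sw_tens ?s1 //; bilin.
- by move=> x; rewrite sw_tens ?hopf_eps1 ?scale1r //; bilin.
- move=> x; rewrite sw_tens; last by bilin.
  rewrite sw_tens; last by bilin.
  rewrite sw_tens; last by bilin.
  by rewrite hopf_delta1 sw_tens ?s1 //; bilin.
- move=> h x /=; rewrite /unit_coact /unit_act sw_tens; last by bilin.
  by rewrite s1 (hcoalg_str0 (hopf_coalgebra H)).
Qed.
Definition ld_unit : long_dimodule H B := LongDimodule unit_long_dimodule.

Lemma colinear_inv M N (f : long_dimodule_hom M N) (g : hom_module_hom N M) :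
  cancel f g -> cancel g f -> is_colinear g.
Proof.
move=> fK gK n; rewrite -{2}[n]gK ldh_colinear sw_sw; last by bilin.
rewrite -[LHS]sw_id; apply: eq_sw => b m0.
by rewrite sw_tens ?fK //; bilin.
Qed.

Lemma ld_bij_iso M N (f : long_dimodule_hom M N) :
  bijective f -> is_iso (f : @Mor long_dimodule_category M N).
Proof.
move=> bf.
have c : is_colinear (M := N) (N := M) (hm_inv bf).
  by apply: colinear_inv; [apply: linvK|apply: linvKr].
exists (LongDimoduleHom c); split; apply: long_dimodule_hom_eq => x /=.
  by rewrite linvK.
by rewrite linvKr.
Qed.

Lemma coact_linv M (m : M) :
  coact (linv mstr m) = \sw_(b, m0 <- coact m) linv hstr b ⊗ linv mstr m0.
Proof.
have bM := mstr_bij M.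
rewrite -{2}[m](linvKr bM) coact_str sw_sw; last by bilin.
rewrite -[LHS]sw_id; apply: eq_sw => b m0.
by rewrite sw_tens ?linvK //; bilin.
Qed.

Lemma hstrV2_assoc a b c :
  linv hstr a ∙ hstrV2 (b ∙ hstr c) = hstrV2 (a ∙ b) ∙ c.
Proof.
have inj : injective (hstr : B -> B) := bij_inj bB.
have V2K x : hstr (hstr (hstrV2 x)) = x by rewrite /hstrV2 !(linvKr bB).
apply/inj/inj; rewrite !(halg_strM (hopf_algebra B)) !V2K (linvKr bB).
exact: halg_assoc (hopf_algebra B) _ _ _.
Qed.

Fact assoc_colinear U V W :
  is_colinear (M := ld_tensor (ld_tensor U V) W)
    (N := ld_tensor U (ld_tensor V W)) (hm_assoc U V W).
Proof.
have l := @assoc_lin k H U V W.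
rewrite /is_colinear /=; apply: tens_ext3.
- exact: (lin_canon (Lin (@tens_coact_lin U (ld_tensor V W))) l).
- apply: lin_swt (@tens_coact_lin (ld_tensor U V) W).
  by split=> ?; [lin|apply: lin_bilr].
move=> u v w; rewrite assocE.
have bl : bilin (fun (b : B) (t : tensor (tensor U V) W) => b ⊗ assoc_map t).
  by split=> ?; [lin|apply: lin_bilr].
rewrite (@sw_tens_coact (ld_tensor U V) W) // sw_tens_coact; last first.
  split=> ?; apply: lin_sw => d w0; first by linV.
  by apply: lin_bilr; apply: (lin_canon (Lin l)); lin.
rewrite (@tens_coactE U (ld_tensor V W)) coact_linv sw_sw; last first.
  by bilin; linV.
apply: eq_sw => b u0; rewrite sw_tens; last by bilin; linV.
rewrite sw_tens_coact; last by bilin; linV.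
apply: eq_sw => c v0; rewrite coact_str sw_sw; last by bilin; linV.
apply: eq_sw => d w0; rewrite sw_tens; last by bilin; linV.
by rewrite assocE hstrV2_assoc.
Qed.
Fact associnv_colinear U V W :
  is_colinear (M := ld_tensor U (ld_tensor V W))
    (N := ld_tensor (ld_tensor U V) W) (hm_associnv U V W).
Proof.
by apply: (colinear_inv (f := LongDimoduleHom (@assoc_colinear U V W)));
  [exact: assoc_mapK|exact: associnv_mapK].
Qed.
Definition ld_assoc U V W := LongDimoduleHom (@assoc_colinear U V W).
Definition ld_associnv U V W := LongDimoduleHom (@associnv_colinear U V W).

Lemma hmul1rV b : hstrV2 (hone ∙ b) = linv hstr b.
Proof. by rewrite (halg_mul1r (hopf_algebra B)) /hstrV2 (linvK bB). Qed.
Lemma hmulr1V b : hstrV2 (b ∙ hone) = linv hstr b.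
Proof. by rewrite (halg_mulr1 (hopf_algebra B)) /hstrV2 (linvK bB). Qed.

Fact lunit_colinear V :
  is_colinear (M := ld_tensor ld_unit V) (N := V) (hm_lunit V).
Proof.
have l := @lunit_lin k H V.
rewrite /is_colinear /=; apply: tens_ext.
- exact: (lin_canon coact l).
- by apply: lin_swt (@tens_coact_lin ld_unit V); split=> ?; [lin|apply: lin_bilr].
move=> x v; rewrite (@sw_tens_coact ld_unit V); last first.
  by split=> ?; [lin|apply: lin_bilr].
rewrite lunitE linearZ coact_linv /= sw_tens; last first.
  split=> ?; apply: lin_sw => c n0; first by linV.
  by apply: lin_bilr; apply: (lin_canon (Lin l)); lin.
rewrite (sw_comp (f := fun t : tensor B V => (x : k) *: t)); last by lin.
by apply: eq_sw => c n0; rewrite hmul1rV lunitE linearZr_LR.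
Qed.
Fact runit_colinear V :
  is_colinear (M := ld_tensor V ld_unit) (N := V) (hm_runit V).
Proof.
have l := @runit_lin k H V.
rewrite /is_colinear /=; apply: tens_ext.
- exact: (lin_canon coact l).
- by apply: lin_swt (@tens_coact_lin V ld_unit); split=> ?; [lin|apply: lin_bilr].
move=> v x; rewrite (@sw_tens_coact V ld_unit); last first.
  by split=> ?; [lin|apply: lin_bilr].
rewrite runitE linearZ coact_linv /=.
rewrite (sw_comp (f := fun t : tensor B V => (x : k) *: t)); last by lin.
apply: eq_sw => c n0; rewrite sw_tens; last first.
  split=> ?; first by linV.
  by apply: lin_bilr; apply: (lin_canon (Lin l)); lin.
by rewrite hmulr1V runitE linearZr_LR.
Qed.
Definition ld_lunit V := LongDimoduleHom (@lunit_colinear V).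
Definition ld_runit V := LongDimoduleHom (@runit_colinear V).

Lemma ldh_hom_inj M N (f g : long_dimodule_hom M N) :
  ldh_hom f = ldh_hom g -> f = g.
Proof. by move=> fg; apply: long_dimodule_hom_eq => m; rewrite fg. Qed.

Fact ld_tensor_id M N : ld_tensor_hom (ld_id M) (ld_id N) = ld_id (ld_tensor M N).
Proof. exact/ldh_hom_inj/hm_tensor_id. Qed.
Fact ld_tensor_comp M M' M'' N N' N'' (f' : long_dimodule_hom M' M'')
    (f : long_dimodule_hom M M') (g' : long_dimodule_hom N' N'')
    (g : long_dimodule_hom N N') :
  ld_tensor_hom (ld_comp f' f) (ld_comp g' g)
  = ld_comp (ld_tensor_hom f' g') (ld_tensor_hom f g).
Proof. exact/ldh_hom_inj/hm_tensor_comp. Qed.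
Fact ld_assocK U V W : ld_comp (ld_associnv U V W) (ld_assoc U V W) = ld_id _.
Proof. exact/ldh_hom_inj/hm_assocK. Qed.
Fact ld_associnvK U V W : ld_comp (ld_assoc U V W) (ld_associnv U V W) = ld_id _.
Proof. exact/ldh_hom_inj/hm_associnvK. Qed.
Fact ld_lunit_iso V : is_iso (ld_lunit V : @Mor long_dimodule_category _ _).
Proof. exact: (@ld_bij_iso _ _ (ld_lunit V) (lunit_map_bij V)). Qed.
Fact ld_runit_iso V : is_iso (ld_runit V : @Mor long_dimodule_category _ _).
Proof. exact: (@ld_bij_iso _ _ (ld_runit V) (runit_map_bij V)). Qed.
Fact ld_assoc_nat U U' V V' W W' (f : long_dimodule_hom U U')
    (g : long_dimodule_hom V V') (h : long_dimodule_hom W W') :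
  ld_comp (ld_assoc U' V' W') (ld_tensor_hom (ld_tensor_hom f g) h) =
  ld_comp (ld_tensor_hom f (ld_tensor_hom g h)) (ld_assoc U V W).
Proof. exact/ldh_hom_inj/hm_assoc_nat. Qed.
Fact ld_lunit_nat V V' (f : long_dimodule_hom V V') :
  ld_comp (ld_lunit V') (ld_tensor_hom (ld_id ld_unit) f) =
  ld_comp f (ld_lunit V).
Proof. exact/ldh_hom_inj/hm_lunit_nat. Qed.
Fact ld_runit_nat V V' (f : long_dimodule_hom V V') :
  ld_comp (ld_runit V') (ld_tensor_hom f (ld_id ld_unit)) =
  ld_comp f (ld_runit V).
Proof. exact/ldh_hom_inj/hm_runit_nat. Qed.
Fact ld_triangle V W :
  ld_comp (ld_tensor_hom (ld_id V) (ld_lunit W)) (ld_assoc V ld_unit W)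
  = ld_tensor_hom (ld_runit V) (ld_id W).
Proof. exact/ldh_hom_inj/hm_triangle. Qed.
Fact ld_pentagon U V W X :
  ld_comp (ld_assoc U V (ld_tensor W X)) (ld_assoc (ld_tensor U V) W X) =
  ld_comp (ld_comp (ld_tensor_hom (ld_id U) (ld_assoc V W X))
    (ld_assoc U (ld_tensor V W) X)) (ld_tensor_hom (ld_assoc U V W) (ld_id X)).
Proof. exact/ldh_hom_inj/hm_pentagon. Qed.

Definition long_dimodule_monoidal : monoidal_category :=
  @MonoidalCategory long_dimodule_category ld_tensor (@ld_tensor_hom) ld_unit
    ld_assoc ld_associnv ld_lunit ld_runit ld_tensor_id (@ld_tensor_comp)
    ld_assocK ld_associnvK ld_lunit_iso ld_runit_iso (@ld_assoc_nat)
    (@ld_lunit_nat) (@ld_runit_nat) ld_triangle ld_pentagon.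

Fact trivial_coaction_lin (M : hom_module H) :
  lin (fun m : M => (hone : B) ⊗ mstr m).
Proof. by lin. Qed.
Definition trivial_coaction (M : hom_module H) : {linear M -> tensor B M} :=
  Lin (@trivial_coaction_lin M).
End LongDimodules.

(* Main.v *)
Require Import Defs.
From mathcomp Require Import all_boot all_algebra.
From mathcomp Require Import boolp.

(* The coaction of a tensor product of trivial comodules is again trivial, since
   beta^-2(1 1) = 1, and H-linear maps are colinear for it, so the embedding is
   strict.  For the braiding, the Hom-action twists every composite by powers of
   the structure maps, and the invariance of R under alpha absorbs all of them;
   H-linearity is then Delta^cop(h) R = R Delta(h), the two hexagons are the two
   coproduct identities for R, and the symmetry is R^(2)R^(1) x R^(1)R^(2) = 1 x 1,
   which also makes the braiding invertible. *)

Set Implicit Arguments.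
Unset Strict Implicit.
Unset Printing Implicit Defensive.

Import GRing.Theory.
Local Open Scope ring_scope.

(** * Hom-modules as Long dimodules with trivial coaction *)

Section TrivialCoaction.
Variables (k : fieldType) (H B : hom_hopf_algebra k).
Implicit Types M N : hom_module H.

Lemma hstr1 : hstr (hone : B) = hone.
Proof. exact: halg_str1 (hopf_algebra B). Qed.

Lemma hstrV2_11 : hstrV2 (hone ∙ hone) = hone :> B.
Proof. by rewrite hmul1rV; apply: linvP hstr1; apply: hstr_bij. Qed.

(** Since beta(1) = 1, Delta(1) = 1 x 1 and eps(1) = 1, the comodule axioms collapse, and the Long
    compatibility becomes mu(h.m) = alpha(h).mu(m). *)
Lemma trivial_coaction_dimodule M : is_long_dimodule (trivial_coaction B M).
Proof.
split; first split=> /=.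
- exact: mstr_bij.
- by move=> m; rewrite sw_tens ?hstr1 //; bilin.
- by move=> m; rewrite sw_tens ?hopf_eps1 ?scale1r //; bilin.
- move=> m; do 3! (rewrite sw_tens; last by bilin).
  by rewrite hopf_delta1 sw_tens ?hstr1 //; bilin.
- by move=> h m /=; rewrite sw_tens ?hstr1 ?mstr_act //; bilin.
Qed.

Definition trivial_dimodule M := LongDimodule (trivial_coaction_dimodule M).

(** For coactions of the form 1 x mu(m), colinearity only asks that [f] commute with the structure
    maps. *)
Lemma trivial_colinear M N (f : hom_module_hom M N) :
  is_colinear (M := trivial_dimodule M) (N := trivial_dimodule N) f.
Proof. by move=> m /=; rewrite sw_tens ?hmh_str //; bilin. Qed.

Definition trivial_hom M N (f : hom_module_hom M N) :
    long_dimodule_hom (trivial_dimodule M) (trivial_dimodule N) :=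
  LongDimoduleHom (@trivial_colinear M N f).

(* Stated for dimodules whose coaction is only propositionally trivial, so that
   it applies to iterated tensor products. *)
Lemma tensor_trivial (M N : long_dimodule H B) :
  coact = trivial_coaction B M -> coact = trivial_coaction B N ->
  trivial_coaction B (hm_tensor M N) = Lin (@tens_coact_lin k H B M N).
Proof.
move=> cM cN; apply: linear_eq; apply: tens_ext.
- exact: (@trivial_coaction_lin k H B (hm_tensor M N)).
- exact: tens_coact_lin.
have bB := hstr_bij B.
move=> m n; rewrite /= tens_coactE cM cN /= tens_mapE.
rewrite sw_tens; last by rewrite /hstrV2; bilin.
rewrite sw_tens; last by rewrite /hstrV2; bilin.
by rewrite hstrV2_11.
Qed.

Lemma trivial_coaction_unit :
  trivial_coaction B (hm_unit H) = Lin (@unit_coact_lin k B).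
Proof. exact: linear_eq. Qed.

Lemma long_dimodule_eq M (r r' : {linear M -> tensor B M})
    (p : is_long_dimodule r) (p' : is_long_dimodule r') :
  r = r' -> LongDimodule p = LongDimodule p'.
Proof.
by move=> e; subst r'; congr LongDimodule; apply: Prop_irrelevance.
Qed.

(** Compares a structure morphism in the image of the embedding with that of the dimodule category:
    both have the same underlying map [f], but their endpoints carry coactions that are only
    propositionally equal. *)
Lemma long_dimodule_arr_eq M N (f : hom_module_hom M N)
    (r r' : {linear M -> tensor B M}) (s s' : {linear N -> tensor B N})
    (p : is_long_dimodule r) (p' : is_long_dimodule r')
    (q : is_long_dimodule s) (q' : is_long_dimodule s')
    (c : is_colinear (M := LongDimodule p) (N := LongDimodule q) f)
    (c' : is_colinear (M := LongDimodule p') (N := LongDimodule q') f) :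
  r = r' -> s = s' ->
  arr (LongDimoduleHom c : @Mor (long_dimodule_category H B) _ _) =
  arr (LongDimoduleHom c' : @Mor (long_dimodule_category H B) _ _).
Proof.
move=> er es; subst r' s'.
(* The type of [c'] mentions [p'] and [q'], so it returns to the goal before these are identified
   with [p] and [q]. *)
move: c'; rewrite (Prop_irrelevance p' p) (Prop_irrelevance q' q) => c'.
by rewrite (Prop_irrelevance c' c).
Qed.

Lemma trivial_monoidal_subcategory :
  is_monoidal_subcategory (C := hom_module_monoidal H)
    (D := long_dimodule_monoidal H B) trivial_dimodule trivial_hom.
Proof.
split=> //=.
- by move=> M; apply: long_dimodule_hom_eq.
- by move=> M N P g f; apply: long_dimodule_hom_eq.
(* Forgetting the coaction gives back the Hom-module. *)
- by move=> M N /(congr1 (@ld_module k H B)).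
- by move=> M N f g /(congr1 (@ldh_hom k H B _ _)).
- move=> M N; apply: long_dimodule_eq.
  exact: (@tensor_trivial (trivial_dimodule M) (trivial_dimodule N)).
- exact/long_dimodule_eq/trivial_coaction_unit.
- move=> M M' N N' f g; apply: long_dimodule_arr_eq.
    exact: (@tensor_trivial (trivial_dimodule M) (trivial_dimodule N)).
  exact: (@tensor_trivial (trivial_dimodule M') (trivial_dimodule N')).
(* Source and target are nested tensor products: [tensor_trivial] is used once for the inner product
   and once for the outer one. *)
- move=> M N P; apply: long_dimodule_arr_eq.
    apply: (@tensor_trivial (ld_tensor (trivial_dimodule M) (trivial_dimodule N))
      (trivial_dimodule P)) => //.
    by apply/esym/(@tensor_trivial (trivial_dimodule M) (trivial_dimodule N)).
  apply: (@tensor_trivial (trivial_dimodule M)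
    (ld_tensor (trivial_dimodule N) (trivial_dimodule P))) => //.
  by apply/esym/(@tensor_trivial (trivial_dimodule N) (trivial_dimodule P)).
- move=> M; apply: long_dimodule_arr_eq => //.
  apply: (@tensor_trivial (ld_unit _ _) (trivial_dimodule M)) => //.
  exact/esym/trivial_coaction_unit.
- move=> M; apply: long_dimodule_arr_eq => //.
  apply: (@tensor_trivial (trivial_dimodule M) (ld_unit _ _)) => //.
  exact/esym/trivial_coaction_unit.
Qed.
End TrivialCoaction.

(** * The axioms of R inside Sweedler sums *)

Section Braiding.
Variables (k : fieldType) (H : hom_hopf_algebra k) (R : tensor H H).
Hypothesis qtR : is_quasitriangular R.
Implicit Types M N P : hom_module H.
Let bH := hstr_bij H.
Let bM M := mstr_bij M.

Ltac hlin := repeat (lin; try exact: bM).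
Ltac hbilin := split=> ?; hlin.

(** Allows alpha to be inserted on both legs of R at once, which supplies the twists that
    Hom-associativity of the action requires. *)
Lemma sw_R_str (V : lmodType k) (F : H -> H -> V) : bilin F ->
  \sw_(R1, R2 <- R) F (hstr R1) (hstr R2) = sw F R.
Proof.
move=> bF; rewrite -{2}(qt_str qtR) sw_sw //.
by apply: eq_sw => R1 R2; rewrite sw_tens.
Qed.

Lemma sw_R_cop (V : lmodType k) (F : H -> H -> V) (h : H) : bilin F ->
  \sw_(h1, h2 <- hdelta h) \sw_(R1, R2 <- R) F (h2 ∙ R1) (h1 ∙ R2) =
  \sw_(R1, R2 <- R) \sw_(h1, h2 <- hdelta h) F (R1 ∙ h1) (R2 ∙ h2).
Proof.
move=> bF; have /(congr1 (sw F)) := qt_cop qtR h; rewrite !sw_sw //.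
under eq_sw => h1 h2.
  rewrite sw_sw //; under eq_sw => R1 R2 do rewrite sw_tens //.
  over.
move=> ->; apply: eq_sw => R1 R2; rewrite sw_sw //.
by apply: eq_sw => h1 h2; rewrite sw_tens.
Qed.

Section Delta.
Variables (V : lmodType k) (G : H -> H -> H -> V).
Hypotheses (G1 : forall b c, lin (fun a => G a b c))
  (G2 : forall a c, lin (fun b => G a b c)) (G3 : forall a b, lin (G a b)).

(** The coproduct axiom for the first leg of R, with the trilinear [G] read as a bilinear map [F] on
    (H x H) and H. *)
Lemma sw_R_deltal :
  \sw_(R1, R2 <- R) \sw_(R11, R12 <- hdelta R1) G R11 R12 (hstr R2) =
  \sw_(R1, R2 <- R) \sw_(r1, r2 <- R) G (hstr R1) (hstr r1) (R2 ∙ r2).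
Proof.
pose F (q : tensor H H) (c : H) : V := \sw_(a, b <- q) G a b c.
have bG c : bilin (fun a b => G a b c) by split=> ?; [exact: G1|exact: G2].
have bF : bilin F.
  split=> [c|q]; rewrite /F; first exact: sw_linear.
  by apply: lin_sw => ? ?; exact: G3.
have /(congr1 (sw F)) := qt_deltal qtR; rewrite !sw_sw //.
under eq_sw => R1 R2 do rewrite sw_tens //.
move=> ->; apply: eq_sw => R1 R2; rewrite sw_sw //.
by apply: eq_sw => r1 r2; rewrite sw_tens // /F sw_tens.
Qed.

Lemma sw_R_deltar :
  \sw_(R1, R2 <- R) \sw_(R21, R22 <- hdelta R2) G (hstr R1) R21 R22 =
  \sw_(R1, R2 <- R) \sw_(r1, r2 <- R) G (R1 ∙ r1) (hstr r2) (hstr R2).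
Proof.
pose F (a : H) (q : tensor H H) : V := \sw_(b, c <- q) G a b c.
have bG a : bilin (G a) by split=> ?; [exact: G2|exact: G3].
have bF : bilin F.
  split=> [q|a]; rewrite /F; last exact: sw_linear.
  by apply: lin_sw => ? ?; exact: G1.
have /(congr1 (sw F)) := qt_deltar qtR; rewrite !sw_sw //.
under eq_sw => R1 R2 do rewrite sw_tens //.
move=> ->; apply: eq_sw => R1 R2; rewrite sw_sw //.
by apply: eq_sw => r1 r2; rewrite sw_tens // /F sw_tens.
Qed.
End Delta.

(** Hom-associativity solved for an outer scalar that is not given as an image of alpha. *)
Lemma act_actV M h h' (m : M) : h ▷ (h' ▷ m) = (linv hstr h ∙ h') ▷ mstr m.
Proof. by rewrite -act_act linvKr. Qed.

(** * The braiding as a morphism of Hom-modules *)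

Section Map.
Variables M N : hom_module H.

Definition braid_map (t : tensor M N) : tensor N M :=
  \sw_(m, n <- t) \sw_(R1, R2 <- R) (R2 ▷ linv mstr n) ⊗ (R1 ▷ linv mstr m).

Lemma braid_lin : lin braid_map.
Proof. by rewrite /braid_map; hlin. Qed.

Lemma braidE m n : braid_map (m ⊗ n) =
  \sw_(R1, R2 <- R) (R2 ▷ linv mstr n) ⊗ (R1 ▷ linv mstr m).
Proof. by rewrite /braid_map sw_tens //; hbilin. Qed.

(* Both sides are [Delta^cop(g) R = R Delta(g)] at [g = alpha^-1(h)], applied
   to [m] and [n]. *)
Lemma braid_act h (t : hm_tensor M N) :
  (Lin braid_lin : _ -> hm_tensor N M) (h ▷ t) =
  h ▷ (Lin braid_lin t : hm_tensor N M).
Proof.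
move: t => /=; apply: tens_ext.
- exact: (lin_canon (Lin braid_lin) ((tens_act_bilin M N).2 h)).
- exact: (lin_canon (Bilin (tens_act_bilin N M) h) braid_lin).
move=> m n; rewrite braidE tens_actE (sw_comp _ _ braid_lin).
rewrite (sw_comp _ _ ((tens_act_bilin N M).2 h)).
pose F (a b : H) : tensor N M := (b ▷ n) ⊗ (a ▷ m).
have bF : bilin F by rewrite /F; hbilin.
have := sw_R_cop (linv hstr h) bF; rewrite hdelta_strV.
rewrite sw_sw; last by rewrite /F; hbilin.
under eq_sw => h1 h2.
  rewrite sw_tens; last by rewrite /F; hbilin.
  over.
under [X in _ = X -> _]eq_sw => R1 R2.
  rewrite sw_sw; last by rewrite /F; hbilin.
  under eq_sw => h1 h2.
    rewrite sw_tens; last by rewrite /F; hbilin.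
    over.
  over.
move=> e; transitivity (\sw_(R1, R2 <- R) \sw_(h1, h2 <- hdelta h)
    F (R1 ∙ linv hstr h1) (R2 ∙ linv hstr h2)); last first.
  rewrite -e sw_swap; apply: eq_sw => R1 R2; rewrite tens_actE.
  by apply: eq_sw => h1 h2; rewrite !act_actV !(linvKr (bM _)).
rewrite sw_swap; apply: eq_sw => h1 h2.
rewrite braidE -sw_R_str; last by hbilin.
by apply: eq_sw => R1 R2; rewrite !linv_act !act_act !linvKr.
Qed.

Lemma braid_str (t : hm_tensor M N) :
  (Lin braid_lin : _ -> hm_tensor N M) (mstr t) =
  mstr (Lin braid_lin t : hm_tensor N M).
Proof.
move: t => /=; apply: tens_ext.
- exact: (lin_canon (Lin braid_lin) (tens_map_lin _ _)).
- exact: (lin_canon (Lin (tens_map_lin _ _)) braid_lin).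
move=> m n; rewrite tens_mapE !braidE (sw_comp _ _ (tens_map_lin _ _)).
rewrite -sw_R_str; last by hbilin.
by apply: eq_sw => R1 R2; rewrite tens_mapE !mstr_act !linvK ?linvKr.
Qed.

Definition braid : hom_module_hom (hm_tensor M N) (hm_tensor N M) :=
  HomModuleHom braid_act braid_str.
End Map.

(** * Naturality, hexagons and symmetry *)

Lemma braid_nat M M' N N' (f : hom_module_hom M M') (g : hom_module_hom N N') :
  hm_comp (braid M' N') (hm_tensor_hom f g) =
  hm_comp (hm_tensor_hom g f) (braid M N).
Proof.
apply: hm_tens_ext => m n; rewrite /= tens_mapE !braidE.
rewrite (sw_comp _ _ (tens_map_lin _ _)).
by apply: eq_sw => R1 R2; rewrite tens_mapE !hmh_act !hm_linv.
Qed.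

Lemma hm_tens_ext3r M N P Q
    (f g : hom_module_hom (hm_tensor M (hm_tensor N P)) Q) :
  (forall m n p, f (m ⊗ (n ⊗ p)) = g (m ⊗ (n ⊗ p))) -> f = g.
Proof.
move=> h; apply: hom_module_hom_eq.
exact: (tens_ext3r (hm_hom_lin f) (hm_hom_lin g) h).
Qed.

(** Crossing N x P in one step acts on it by the coproduct of R^(2); [sw_R_deltar] splits this into
    two copies of R, one for each single crossing. *)
Lemma braid_hexagon M N P :
  hm_comp (hm_comp (hm_assoc N P M) (braid M (hm_tensor N P))) (hm_assoc M N P) =
  hm_comp (hm_comp (hm_tensor_hom (hm_id N) (braid M P)) (hm_assoc N M P))
    (hm_tensor_hom (braid M N) (hm_id P)).
Proof.
have lA := @assoc_lin k H N P M.
apply: hm_tens_ext3 => m n p; rewrite /= assocE tens_mapE /= !braidE.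
(* [a], [b], [c] act on M, N, P; the inverses record the twists left by the associator and the
   braiding. *)
pose G (a b c : H) : tensor N (tensor P M) :=
  (linv hstr b ▷ linv mstr (linv mstr n)) ⊗ ((c ▷ p) ⊗ (a ▷ linv mstr m)).
have G1 b c : lin (fun a => G a b c) by rewrite /G; hlin.
have G2 a c : lin (fun b => G a b c) by rewrite /G; hlin.
have G3 a b : lin (G a b) by rewrite /G; hlin.
transitivity (\sw_(R1, R2 <- R) \sw_(R21, R22 <- hdelta R2) G (hstr R1) R21 R22).
  rewrite (sw_comp _ _ lA); apply: eq_sw => R1 R2.
  rewrite linv_tens [X in X ⊗ _](tens_actE (M := N) (N := P)).
  rewrite (sw_comp (f := fun x => assoc_map (x ⊗ _))); last first.
    by apply: (lin_canon (Lin lA)); lin.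
  apply: eq_sw => R21 R22.
  by rewrite assocE linv_act mstr_act (linvKr (bM _)) (linvK (bM _)).
(* The swap puts outside the copy of R used by the first crossing, of M and N, to match the order of
   composition on the right. *)
rewrite sw_R_deltar // sw_swap.
rewrite (sw_comp (f := fun x => tens_map _ _ (assoc_map (x ⊗ _)))); last first.
  by apply: (lin_canon (Lin (tens_map_lin _ _)));
    apply: (lin_canon (Lin (assoc_lin (U := N) (V := M) (W := P)))); lin.
rewrite -[RHS]sw_R_str; last first.
  by split=> ?; apply: (lin_canon (Lin (tens_map_lin _ _)));
    apply: (lin_canon (Lin (assoc_lin (U := N) (V := M) (W := P)))); hlin.
apply: eq_sw => r1 r2.
rewrite assocE tens_mapE /= braidE (linvK (bM _)).
rewrite (sw_comp (f := fun x => _ ⊗ x)); last by hlin.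
rewrite -[RHS]sw_R_str; last by hbilin.
apply: eq_sw => R1 R2.
by rewrite /G !linv_act act_act !(linvK bH) !(linvKr (bM _)).
Qed.

(** The mirror argument: M x N crosses P by the coproduct of R^(1), split by [sw_R_deltal]. *)
Lemma braid_hexagonV M N P :
  hm_comp (hm_comp (hm_associnv P M N) (braid (hm_tensor M N) P)) (hm_associnv M N P) =
  hm_comp (hm_comp (hm_tensor_hom (braid M P) (hm_id N)) (hm_associnv M P N))
    (hm_tensor_hom (hm_id M) (braid N P)).
Proof.
have lA := @associnv_lin k H P M N.
apply: hm_tens_ext3r => m n p; rewrite /= associnvE tens_mapE /= !braidE.
pose G (a b c : H) : tensor (tensor P M) N :=
  ((c ▷ linv mstr p) ⊗ (a ▷ m)) ⊗ (linv hstr b ▷ linv mstr (linv mstr n)).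
have G1 b c : lin (fun a => G a b c) by rewrite /G; hlin.
have G2 a c : lin (fun b => G a b c) by rewrite /G; hlin.
have G3 a b : lin (G a b) by rewrite /G; hlin.
transitivity (\sw_(R1, R2 <- R) \sw_(R11, R12 <- hdelta R1) G R11 R12 (hstr R2)).
  rewrite (sw_comp _ _ lA); apply: eq_sw => R1 R2.
  rewrite linv_tens [X in _ ⊗ X](tens_actE (M := M) (N := N)).
  rewrite (sw_comp (f := fun x => associnv_map (_ ⊗ x))); last first.
    by apply: (lin_canon (Lin lA)); lin.
  apply: eq_sw => R11 R12.
  by rewrite associnvE linv_act mstr_act (linvKr (bM _)) (linvK (bM _)).
rewrite sw_R_deltal // sw_swap.
rewrite (sw_comp (f := fun x => tens_map _ _ (associnv_map (_ ⊗ x)))); last first.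
  by apply: (lin_canon (Lin (tens_map_lin _ _)));
    apply: (lin_canon (Lin (associnv_lin (U := M) (V := P) (W := N)))); lin.
rewrite -[RHS]sw_R_str; last first.
  by split=> ?; apply: (lin_canon (Lin (tens_map_lin _ _)));
    apply: (lin_canon (Lin (associnv_lin (U := M) (V := P) (W := N)))); hlin.
apply: eq_sw => r1 r2.
rewrite associnvE tens_mapE /= braidE (linvK (bM _)).
rewrite (sw_comp (f := fun x => x ⊗ _)); last by hlin.
rewrite -[RHS]sw_R_str; last by hbilin.
apply: eq_sw => R1 R2.
by rewrite /G !linv_act act_act !(linvK bH) !(linvKr (bM _)).
Qed.

Lemma braidK M N :
  \sw_(R1, R2 <- R) \sw_(r1, r2 <- R) (r2 ∙ R1) ⊗ (r1 ∙ R2) = hone ⊗ hone ->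
  hm_comp (braid N M) (braid M N) = hm_id (hm_tensor M N).
Proof.
move=> RK; have lC := @braid_lin N M.
apply: hm_tens_ext => m n; rewrite /= braidE (sw_comp _ _ lC).
pose F (a b : H) : tensor M N := (a ▷ linv mstr m) ⊗ (b ▷ linv mstr n).
have bF : bilin F by rewrite /F; hbilin.
transitivity (sw F (hone ⊗ hone)); last first.
  by rewrite sw_tens // /F !act_one !(linvKr (bM _)).
(* Shifting both copies of R by alpha turns the double action on m into alpha(r2).(R1.mu^-2(m)) =
   (r2 R1).mu^-1(m), and likewise on n. *)
rewrite -RK sw_sw // -[LHS]sw_R_str; last first.
  by split=> ?; apply: (lin_canon (Lin lC)); hlin.
apply: eq_sw => R1 R2; rewrite sw_sw // braidE -[LHS]sw_R_str; last by hbilin.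
apply: eq_sw => r1 r2; rewrite sw_tens // /F.
by rewrite !linv_act !(linvK bH) !act_act !(linvKr (bM _)).
Qed.
End Braiding.

Theorem proposition4p1 (k : fieldType) (H B : hom_hopf_algebra k)
    (R : tensor H H) (HR : is_triangular R) :
  exists (dimodP : forall M : hom_module H,
            is_long_dimodule (trivial_coaction B M))
         (colinP : forall (M N : hom_module H) (f : hom_module_hom M N),
            is_colinear (M := LongDimodule (dimodP M))
              (N := LongDimodule (dimodP N)) f)
         (C : forall M N : hom_module H,
            hom_module_hom (hm_tensor M N) (hm_tensor N M)),
    [/\ is_monoidal_subcategory (C := hom_module_monoidal H)
          (D := long_dimodule_monoidal H B)
          (fun M => LongDimodule (dimodP M))
          (fun M N f => LongDimoduleHom (colinP M N f)),
        forall (M N : hom_module H) (m : M) (n : N),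
          C M N (m ⊗ n) =
          \sw_(R1, R2 <- R) (R2 ▷ linv mstr n) ⊗ (R1 ▷ linv mstr m)
      & is_symmetry (C := hom_module_monoidal H) C].
Proof.
have qtR := tri_qt HR; have RK := tri_invl HR.
exists (trivial_coaction_dimodule B), (@trivial_colinear k H B), (braid qtR).
split.
- exact: trivial_monoidal_subcategory.
- exact: braidE.
split=> [|M N]; last exact: braidK.
split=> /=.
(* [braidK], with the two modules in either order, gives both inverse laws. *)
- by move=> M N; exists (braid qtR N M); split; apply: braidK.
- exact: braid_nat.
- exact: braid_hexagon.
- exact: braid_hexagonV.
Qed.
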